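(* Let $k$ be a positive integer and let $\Lambda$ be a left and right Noetherian ring which is right quasi $k$-Gorenstein. Then the following statements are equivalent. (1) $\mathrm{id}_{\Lambda^{op}}\Lambda\le k$, i.e. the injective dimension of $\Lambda$ as a right $\Lambda$-module is at most $k$. (2) Each finitely generated left $\Lambda$-module with reduced grade at least $k+1$ is reflexive. (3) Each finitely generated left $\Lambda$-module with reduced grade at least $k+1$ is torsionless.
   Context: Let $0\to\Lambda_\Lambda\to I_0\to I_1\to\cdots$ be a minimal injective resolution of $\Lambda$ as a right $\Lambda$-module. $\Lambda$ is called right quasi $k$-Gorenstein if the flat dimension of the right module $I_i$ is at most $i+1$ for all $0\le i\le k-1$. A finitely generated left module $M$ has reduced grade at least $n$ (for a positive integer $n$) if $\mathrm{Ext}^j_\Lambda(M,\Lambda)=0$ for all $1\le j<n$. Write $(\ )^*=\mathrm{Hom}(\ ,\Lambda)$ and let $\sigma_M:M\to M^{**}$, $\sigma_M(x)(f)=f(x)$, be the canonical evaluation map. $M$ is torsionless if $\sigma_M$ is a monomorphism, and reflexive if $\sigma_M$ is an isomorphism. *)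

(* Defs.v *)
From HB Require Import structures.
From mathcomp Require Import all_boot all_algebra.
From mathcomp Require Import boolp.
From mathcomp Require Import freeg.

Set Implicit Arguments.
Unset Strict Implicit.
Unset Printing Implicit Defensive.

Import GRing.Theory.
Local Open Scope ring_scope.
Local Open Scope quotient_scope.

(* Left R-modules are [lmodType R].  Right R-modules are [lmodType R^c], with *)
(* x . a written (a : R^c) *: x; thus the regular left module is R^o and the  *)
(* regular right module is (R^c)^o.  Submodules are Boolean predicates        *)
(* satisfying [GRing.submod_closed]; with [boolp] every Prop-valued predicate *)
(* is of this form.                                                           *)

Section Finiteness.
Variable R : pzRingType.

Definition fin_gen (M : lmodType R) : Prop :=
  exists (n : nat) (g : 'I_n -> M),
    forall x : M, exists c : 'I_n -> R, x = \sum_i c i *: g i.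

Definition fin_gen_sub (M : lmodType R) (S : {pred M}) : Prop :=
  exists (n : nat) (g : 'I_n -> M),
    (forall i, g i \in S) /\
    forall x : M, x \in S -> exists c : 'I_n -> R, x = \sum_i c i *: g i.

Definition noetherian_module (M : lmodType R) : Prop :=
  forall S : {pred M}, GRing.submod_closed S -> fin_gen_sub S.

End Finiteness.

Definition left_noetherian (R : pzRingType) : Prop := noetherian_module R^o.
Definition right_noetherian (R : pzRingType) : Prop :=
  noetherian_module (R^c)^o.

Section Dual.
Variables (S : pzRingType) (N : lmodType S).

Definition dual : Type := {linear N -> S^o}.

HB.instance Definition _ := gen_eqMixin dual.
HB.instance Definition _ := gen_choiceMixin dual.

Definition dual_app (f : dual) (x : N) : S := (f : {linear N -> S^o}) x.

Lemma dualP (f g : dual) : (forall x, dual_app f x = dual_app g x) -> f = g.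
Proof.
case: f g => [f [[a1] [a2]]] [g [[b1] [b2]]] efg.
have {}efg : f = g by apply/funext => x; exact: efg.
by subst g; rewrite (Prop_irrelevance a1 b1) (Prop_irrelevance a2 b2).
Qed.

Definition dual_zero : dual := (\0 : {linear N -> S^o}).
Definition dual_opp (f : dual) : dual := (\- f : {linear N -> S^o}).
Definition dual_add (f g : dual) : dual := (f \+ g : {linear N -> S^o}).

Fact dual_addA : associative dual_add.
Proof. by move=> f g h; apply: dualP => x; exact: addrA. Qed.
Fact dual_addC : commutative dual_add.
Proof. by move=> f g; apply: dualP => x; exact: addrC. Qed.
Fact dual_add0 : left_id dual_zero dual_add.
Proof. by move=> f; apply: dualP => x; exact: add0r. Qed.
Fact dual_addN : left_inverse dual_zero dual_opp dual_add.
Proof. by move=> f; apply: dualP => x; exact: addNr. Qed.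

HB.instance Definition _ :=
  GRing.isZmodule.Build dual dual_addA dual_addC dual_add0 dual_addN.

Definition dual_scale_fun (a : S) (f : dual) (x : N) : S^o := dual_app f x * a.

Fact dual_scale_fun_linear (a : S) (f : dual) : linear (dual_scale_fun a f).
Proof.
move=> b x y; rewrite /dual_scale_fun /dual_app linearP mulrDl.
by rewrite /GRing.scale /= mulrA.
Qed.

HB.instance Definition _ (a : S) (f : dual) :=
  GRing.isLinear.Build S N S^o *:%R (dual_scale_fun a f)
    (dual_scale_fun_linear a f).

(* (f . a)(x) = f(x) a, so the dual is a module over the opposite ring *)
Definition dual_scale (a : S^c) (f : dual) : dual :=
  (dual_scale_fun a f : {linear N -> S^o}).

Fact dual_scaleA (a b : S^c) (f : dual) :
  dual_scale a (dual_scale b f) = dual_scale (a * b) f.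
Proof. by apply: dualP => x; exact/esym/mulrA. Qed.
Fact dual_scale1 : left_id 1 dual_scale.
Proof. by move=> f; apply: dualP => x; exact: mulr1. Qed.
Fact dual_scaleDr : right_distributive dual_scale +%R.
Proof. by move=> a f g; apply: dualP => x; exact: mulrDl. Qed.
Fact dual_scaleDl (f : dual) : {morph dual_scale^~ f : a b / a + b}.
Proof. by move=> a b; apply: dualP => x; exact: mulrDr. Qed.

HB.instance Definition _ := GRing.Zmodule_isLmodule.Build S^c dual
  dual_scaleA dual_scale1 dual_scaleDr dual_scaleDl.

End Dual.

(* For a right R-module N, [dual N] is a module over (R^c)^c, which has the   *)
(* same operations as R; [rdual N] is the same group as a left R-module.      *)
Section RightDual.
Variables (R : pzRingType) (N : lmodType R^c).

Definition rdual : Type := dual N.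
HB.instance Definition _ := GRing.Zmodule.on rdual.

Definition rdual_scale (a : R) (g : rdual) : rdual :=
  (a : (R^c)^c) *: (g : dual N).

Fact rdual_scaleA (a b : R) (g : rdual) :
  rdual_scale a (rdual_scale b g) = rdual_scale (a * b) g.
Proof. exact: (@scalerA _ (dual N)). Qed.
Fact rdual_scale1 : left_id 1 rdual_scale.
Proof. exact: (@scale1r _ (dual N)). Qed.
Fact rdual_scaleDr : right_distributive rdual_scale +%R.
Proof. exact: (@scalerDr _ (dual N)). Qed.
Fact rdual_scaleDl (g : rdual) : {morph rdual_scale^~ g : a b / a + b}.
Proof. exact: (@scalerDl _ (dual N)). Qed.

HB.instance Definition _ := GRing.Zmodule_isLmodule.Build R rdual
  rdual_scaleA rdual_scale1 rdual_scaleDr rdual_scaleDl.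

End RightDual.

Section Evaluation.
Variables (R : pzRingType) (M : lmodType R).

Definition bidual : lmodType R := rdual (dual M).

Definition eval_fun (x : M) (f : dual M) : (R^c)^o := dual_app f x.

Fact eval_fun_linear (x : M) : linear (eval_fun x).
Proof. by []. Qed.

HB.instance Definition _ (x : M) :=
  GRing.isLinear.Build R^c (dual M) (R^c)^o *:%R (eval_fun x)
    (eval_fun_linear x).

Definition sigma (x : M) : bidual := (eval_fun x : {linear dual M -> (R^c)^o}).

Fact sigma_linear : linear sigma.
Proof. by move=> a x y; apply: dualP => f; exact: linearP. Qed.

HB.instance Definition _ := GRing.isLinear.Build R M bidual *:%R sigma
  sigma_linear.

Definition torsionless : Prop := injective sigma.
Definition reflexive_module : Prop := bijective sigma.

End Evaluation.

Section Tensor.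
Variables (R : pzRingType) (I : lmodType R^c) (M : lmodType R).

(* the subgroup of the free abelian group on I * M defining I (x)_R M *)
Inductive tensor_rel : {freeg (I * M)%type} -> Prop :=
| tensor_rel0 : tensor_rel 0
| tensor_relB u v : tensor_rel u -> tensor_rel v -> tensor_rel (u - v)
| tensor_relDl x y m :
    tensor_rel (<< (x + y, m) >> - << (x, m) >> - << (y, m) >>)
| tensor_relDr x m n :
    tensor_rel (<< (x, m + n) >> - << (x, m) >> - << (x, n) >>)
| tensor_relZ x (a : R) m :
    tensor_rel (<< ((a : R^c) *: x, m) >> - << (x, a *: m) >>).

Definition tensor_relb : {pred {freeg (I * M)%type}} :=
  fun u => `[< tensor_rel u >].

Fact tensor_relb_zmod_closed : GRing.zmod_closed tensor_relb.
Proof.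
split=> [|u v]; first exact/asboolP/tensor_rel0.
by move=> /asboolP uI /asboolP vI; apply/asboolP/tensor_relB.
Qed.

HB.instance Definition _ :=
  GRing.isZmodClosed.Build _ tensor_relb tensor_relb_zmod_closed.

Definition tensor : zmodType := Quotient.quot tensor_relb.

Definition tensor_pi (u : {freeg (I * M)%type}) : tensor := \pi_tensor u.
Definition tensor_elt (x : I) (m : M) : tensor := tensor_pi << (x, m) >>.

End Tensor.

Section TensorMap.
Variables (R : pzRingType) (I : lmodType R^c) (M N : lmodType R).
Variable f : {linear M -> N}.

Definition freeg_map : {freeg (I * M)%type} -> {freeg (I * N)%type} :=
  fglift (fun p : I * M => << (p.1, f p.2) >> : {freeg (I * N)%type}).

(* id_I (x) f *)
Definition tensor_map (t : tensor I M) : tensor I N :=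
  tensor_pi (freeg_map (repr t)).

Fact freeg_map_is_zmod_morphism : zmod_morphism freeg_map.
Proof. by move=> u v; rewrite /freeg_map lift_is_additive. Qed.

HB.instance Definition _ :=
  GRing.isZmodMorphism.Build _ _ freeg_map freeg_map_is_zmod_morphism.

Fact freeg_mapU p : freeg_map << p >> = << (p.1, f p.2) >>.
Proof. by rewrite /freeg_map liftU scale1r. Qed.

Fact tensor_rel_map u : tensor_rel u -> tensor_rel (freeg_map u).
Proof.
elim=> [|{}u v _ uI _ vI|x y m|x m n|x a m];
  rewrite ?raddf0 ?raddfB /= ?freeg_mapU ?linearD ?linearZ /=.
- exact: tensor_rel0.
- exact: tensor_relB.
- exact: tensor_relDl.
- exact: tensor_relDr.
- exact: tensor_relZ.
Qed.

Lemma tensor_map_pi u : tensor_map (tensor_pi u) = tensor_pi (freeg_map u).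
Proof.
rewrite /tensor_map /tensor_pi; apply/eqP.
rewrite -Quotient.idealrBE -raddfB.
apply/asboolP/tensor_rel_map/asboolP.
by rewrite -[`[< _ >]]/(_ \in @tensor_relb R I M) Quotient.idealrBE reprK.
Qed.

Lemma tensor_map_elt x m : tensor_map (tensor_elt x m) = tensor_elt x (f m).
Proof. by rewrite /tensor_elt tensor_map_pi freeg_mapU. Qed.

End TensorMap.

Section Classes.
Variable R : pzRingType.

Definition injective_module (E : lmodType R) : Prop :=
  forall (A B : lmodType R) (i : {linear A -> B}) (g : {linear A -> E}),
    injective i -> exists h : {linear B -> E}, forall x, h (i x) = g x.

Definition projective_module (P : lmodType R) : Prop :=
  forall (B C : lmodType R) (p : {linear B -> C}) (g : {linear P -> C}),
    (forall c, exists b, p b = c) ->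
    exists h : {linear P -> B}, forall x, p (h x) = g x.

Definition flat_right_module (I : lmodType R^c) : Prop :=
  forall (M N : lmodType R) (f : {linear M -> N}),
    injective f -> injective (@tensor_map R I M N f).

End Classes.

Section Resolutions.
Variable R : pzRingType.

(* ... -> X_1 -> X_0 -> M -> 0 exact, with every X_i in the class C *)
Record resolution (C : lmodType R -> Prop) (M : lmodType R) := Resolution {
  res_obj :> nat -> lmodType R;
  res_aug : {linear res_obj 0%N -> M};
  res_d : forall i, {linear res_obj i.+1 -> res_obj i};
  res_class : forall i, C (res_obj i);
  res_aug_surj : forall m, exists x, res_aug x = m;
  res_exact0 : forall x, res_aug x = 0 <-> exists y, res_d 0%N y = x;
  res_exactS : forall i x, res_d i x = 0 <-> exists y, res_d i.+1 y = x
}.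

(* 0 -> M -> X_0 -> X_1 -> ... exact, with every X_i in the class C *)
Record coresolution (C : lmodType R -> Prop) (M : lmodType R) := Coresolution {
  cores_obj :> nat -> lmodType R;
  cores_aug : {linear M -> cores_obj 0%N};
  cores_d : forall i, {linear cores_obj i -> cores_obj i.+1};
  cores_class : forall i, C (cores_obj i);
  cores_aug_inj : injective cores_aug;
  cores_exact0 : forall x, cores_d 0%N x = 0 <-> exists m, cores_aug m = x;
  cores_exactS : forall i x,
    cores_d i.+1 x = 0 <-> exists y, cores_d i y = x
}.

(* the image of f meets every nonzero submodule of B nontrivially *)
Definition essential_image (A B : lmodType R) (f : {linear A -> B}) : Prop :=
  forall S : {pred B}, GRing.submod_closed S ->
    (exists2 y, y \in S & y != 0) ->
    exists2 a, f a \in S & f a != 0.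

(* Each I_i is an injective envelope of the corresponding cosyzygy. *)
Definition minimal_injective_resolution (M : lmodType R)
    (I : coresolution (@injective_module R) M) : Prop :=
  essential_image (cores_aug I) /\
  forall i, essential_image (cores_d I i).

Definition inj_dim_le (M : lmodType R) (n : nat) : Prop :=
  exists I : coresolution (@injective_module R) M,
    forall i, (n < i)%N -> forall x : I i, x = 0.

(* Ext^j(M, N) = 0: the complex Hom(P, N) is exact in degree j. *)
Definition is_coboundary (M N : lmodType R)
    (P : resolution (@projective_module R) M) (j : nat) :
    {linear P j -> N} -> Prop :=
  match j return {linear P j -> N} -> Prop with
  | 0%N => fun f => forall x, f x = 0
  | i.+1 => fun f =>
      exists g : {linear P i -> N}, forall x, f x = g (res_d P i x)
  end.

Definition Ext_zero (j : nat) (M N : lmodType R) : Prop :=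
  forall (P : resolution (@projective_module R) M) (f : {linear P j -> N}),
    (forall x, f (res_d P j x) = 0) -> is_coboundary f.

Definition reduced_grade_ge (n : nat) (M : lmodType R) : Prop :=
  forall j, (1 <= j < n)%N -> Ext_zero j M R^o.

End Resolutions.

Definition flat_dim_right_le (R : pzRingType) (M : lmodType R^c) (n : nat) :
    Prop :=
  exists F : resolution (@flat_right_module R) M,
    forall i, (n < i)%N -> forall x : F i, x = 0.

(* A minimal injective resolution exists and is unique up to isomorphism, so  *)
(* it does not matter which one is used.                                      *)
Definition right_quasi_gorenstein (k : nat) (R : pzRingType) : Prop :=
  exists I : coresolution (@injective_module R^c) (R^c)^o,
    minimal_injective_resolution I /\
    forall i, (i < k)%N -> flat_dim_right_le (I i) i.+1.

(* Main.v *)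
(* Finitely generated free modules are handled through matrices: a matrix     *)
(* acts on rows (left modules) and on columns (right modules), and a right    *)
(* module F enters through rows of elements of F.                             *)
(*                                                                            *)
(* (1) => (2): if Ext^j(M, R) = 0 for 1 <= j <= k, the dual of a resolution   *)
(* of M is an exact complex of columns, so the transpose of M is a k-th       *)
(* syzygy; as id R <= k, dimension shifting kills its first two Ext groups,   *)
(* which are the kernel and the cokernel of M -> M**.                         *)
(*                                                                            *)
(* (3) => (1): let D be a resolution of a cyclic right module R/J and M the   *)
(* cokernel of the dual of its (k+1)-st differential.  If M is torsionless    *)
(* then Ext^(k+1)(R/J, R) = 0, and minimality of the injective resolution I   *)
(* forces I_i = 0 for i > k.  It remains to see that E = Ext^j(M, R) vanishes *)
(* for 1 <= j <= k.  As I_i has flat dimension at most i+1,                   *)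
(* Hom(E, I_i) = Tor_j(I_i, M) = 0 for i <= j-2, whence Ext^i(C, R) = 0 for   *)
(* i <= j-2 and every cyclic submodule C of E.  The mapping cone of the       *)
(* comparison between D and the dual of a resolution of M embeds E into the   *)
(* cokernel of an exact sequence of j-2 free modules, so the vanishing of     *)
(* these Ext groups lifts C -> E to a map from C to a torsionless module;     *)
(* since Hom(C, R) = 0, C is zero.                                            *)

Require Import Defs.
From HB Require Import structures.
From mathcomp Require Import all_boot all_algebra.
From mathcomp Require Import boolp.
From mathcomp Require Import freeg.

Set Implicit Arguments.
Unset Strict Implicit.
Unset Printing Implicit Defensive.

Import GRing.Theory.
Local Open Scope ring_scope.
Local Open Scope quotient_scope.

(** * Matrices as maps of free modules *)

(** A row over a right module F is both a map from free columns to F and an element of F tensored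
    with free rows, so [vmul] computes Hom out of column complexes and tensor products with row
    complexes by the same formula.

    [cosyzygy_lift] at level s is the vanishing of a first Ext with values in the s-th cosyzygy of
    R. Dimension shifting ([cosyzygy_lift_down], [cosyzygy_lift_up]) trades levels for steps along a
    column complex; level 0 is exactness of rows ([cosyzygy_lift0]).

    (1) to (2): if the dual of the resolution of M is exact in degrees 1 to k, then id R <= k makes
    every positive level hold at its start ([inj_dim_cosyzygy_lift]). One shift down gives
    injectivity of [sigma] ([torsionlessP]), two give surjectivity ([bidual_surj]).

    (3) to (1): torsionlessness of the transposed syzygy is level 0; k shifts up give level k for a
    cyclic module R/J, and minimality turns this into the vanishing of the differential on I_k
    ([torsionless_inj_dim]). That the syzygy has the required reduced grade is the hard part
    ([syzygy_col_exact]): for a class y in one of its Ext groups, the flat dimensions kill Hom(yR,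
    I_i) for small i ([cocycle_hom_eq0]), so low Ext groups of yR into R vanish, and then y is a
    boundary by descent along a mapping cone ([cone_boundary_lift]). *)

Section Submodule.
Variables (R : pzRingType) (V : lmodType R) (T : submodClosed V).

Definition submodule : Type := {x : V | x \in T}.
HB.instance Definition _ := Choice.on submodule.
HB.instance Definition _ := SubType.on submodule.
HB.instance Definition _ := [SubChoice_isSubLmodule of submodule by <:].

Fact submodule_val_linear : linear (val : submodule -> V).
Proof. by move=> c u v; rewrite linearP. Qed.

End Submodule.

Definition rowspan (R : pzRingType) a b (A : 'M[R]_(a, b)) : {pred 'rV[R]_b} :=
  fun x => `[< exists w : 'rV[R]_a, x = w *m A >].

(** Rows are mapped from left to right, columns (in [col_exact]) from right to left; both notions
    are exactness at the middle term. *)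
Definition row_exact (R : pzRingType) a b c
    (A : 'M[R]_(a, b)) (B : 'M[R]_(b, c)) : Prop :=
  A *m B = 0 /\
  forall x : 'rV[R]_b, x *m B = 0 -> exists w : 'rV[R]_a, x = w *m A.

Definition col_exact (R : pzRingType) a b c
    (A : 'M[R]_(a, b)) (B : 'M[R]_(b, c)) : Prop :=
  A *m B = 0 /\
  forall y : 'cV[R]_b, A *m y = 0 -> exists z : 'cV[R]_c, y = B *m z.

Section Rowspan.
Variables (R : pzRingType) (a b : nat) (A : 'M[R]_(a, b)).

Lemma rowspanP (x : 'rV[R]_b) :
  reflect (exists w : 'rV[R]_a, x = w *m A) (x \in rowspan A).
Proof. exact: asboolP. Qed.

Lemma mem_rowspan (w : 'rV[R]_a) : w *m A \in rowspan A.
Proof. by apply/rowspanP; exists w. Qed.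

Fact rowspan_submod_closed : GRing.submod_closed (rowspan A).
Proof.
split=> [|c _ _ /rowspanP[u ->] /rowspanP[v ->]]; apply/rowspanP.
  by exists 0; rewrite mul0mx.
by exists (c *: u + v); rewrite mulmxDl scalemxAl.
Qed.

HB.instance Definition _ :=
  GRing.isSubmodClosed.Build R 'rV[R]_b (rowspan A) rowspan_submod_closed.

Definition coker : Type := Quotient.quot (rowspan A).
HB.instance Definition _ := GRing.Zmodule.on coker.

Definition coker_pi (x : 'rV[R]_b) : coker := \pi_(Quotient.quot (rowspan A)) x.

Definition coker_repr (m : coker) : 'rV[R]_b :=
  repr (m : Quotient.quot (rowspan A)).

Lemma coker_reprK m : coker_pi (coker_repr m) = m.
Proof. exact: (@reprK _ (Quotient.quot (rowspan A))). Qed.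

Lemma coker_piB : {morph coker_pi : x y / x - y}.
Proof. by move=> x y; rewrite /coker_pi !piE. Qed.

Lemma coker_piD : {morph coker_pi : x y / x + y}.
Proof. by move=> x y; rewrite /coker_pi !piE. Qed.

Lemma coker_pi_eq (x y : 'rV[R]_b) :
  coker_pi x = coker_pi y <-> x - y \in rowspan A.
Proof.
rewrite Quotient.idealrBE /coker_pi; split; first by move=> e; apply/eqP.
by move/eqP.
Qed.

Lemma coker_pi0 (x : 'rV[R]_b) : coker_pi x = 0 <-> x \in rowspan A.
Proof.
have <- : coker_pi 0 = 0 by rewrite -[0](subrr 0) coker_piB subrr.
by rewrite coker_pi_eq subr0.
Qed.

Definition coker_scale (c : R) (m : coker) : coker :=
  coker_pi (c *: coker_repr m).

Lemma coker_piZ c x : coker_pi (c *: x) = coker_scale c (coker_pi x).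
Proof.
apply/coker_pi_eq; rewrite -scalerBr rpredZ //.
by apply/coker_pi_eq; rewrite coker_reprK.
Qed.

Fact coker_scaleA c d m :
  coker_scale c (coker_scale d m) = coker_scale (c * d) m.
Proof. by rewrite -(coker_reprK m) -!coker_piZ scalerA. Qed.
Fact coker_scale1 : left_id 1 coker_scale.
Proof. by move=> m; rewrite -(coker_reprK m) -coker_piZ scale1r. Qed.
Fact coker_scaleDr : right_distributive coker_scale +%R.
Proof.
move=> c m n; rewrite -(coker_reprK m) -(coker_reprK n).
by rewrite -coker_piD -!coker_piZ -coker_piD scalerDr.
Qed.
Fact coker_scaleDl m : {morph coker_scale^~ m : c d / c + d}.
Proof.
by move=> c d; rewrite -(coker_reprK m) -!coker_piZ -coker_piD scalerDl.
Qed.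

HB.instance Definition _ := GRing.Zmodule_isLmodule.Build R coker
  coker_scaleA coker_scale1 coker_scaleDr coker_scaleDl.

Fact coker_pi_linear : linear coker_pi.
Proof. by move=> c x y; rewrite coker_piD coker_piZ. Qed.

HB.instance Definition _ :=
  GRing.isLinear.Build R 'rV[R]_b coker *:%R coker_pi coker_pi_linear.

End Rowspan.

(* Entries of A are seen in R^c: they act on the right of the elements of F. *)
Definition vmul (R : pzRingType) (F : lmodType R^c) a b
    (x : 'rV[F]_a) (A : 'M[R]_(a, b)) : 'rV[F]_b :=
  \row_j \sum_i (A i j : R^c) *: x 0 i.

Section Vmul.
Variables (R : pzRingType) (F : lmodType R^c).

Lemma vmulBl a b (A : 'M[R]_(a, b)) (x y : 'rV[F]_a) :
  vmul (x - y) A = vmul x A - vmul y A.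
Proof.
apply/rowP=> j; rewrite !mxE -sumrB.
by apply: eq_bigr => i _; rewrite !mxE scalerBr.
Qed.

Lemma vmul0l a b (A : 'M[R]_(a, b)) : vmul (0 : 'rV[F]_a) A = 0.
Proof. by rewrite -[0](subrr 0) vmulBl subrr. Qed.

Lemma vmul0r a b (x : 'rV[F]_a) : vmul x (0 : 'M[R]_(a, b)) = 0.
Proof.
by apply/rowP=> j; rewrite !mxE big1 // => i _; rewrite mxE (@scale0r R^c).
Qed.

Lemma vmulDr a b (x : 'rV[F]_a) (A B : 'M[R]_(a, b)) :
  vmul x (A + B) = vmul x A + vmul x B.
Proof.
apply/rowP=> j; rewrite !mxE -big_split /=.
by apply: eq_bigr => i _; rewrite !mxE -scalerDl.
Qed.

Lemma vmulBr a b (x : 'rV[F]_a) (A B : 'M[R]_(a, b)) :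
  vmul x (A - B) = vmul x A - vmul x B.
Proof. by apply/eqP; rewrite eq_sym subr_eq -vmulDr subrK. Qed.

Lemma vmulA a b c (x : 'rV[F]_a) (A : 'M[R]_(a, b)) (B : 'M[R]_(b, c)) :
  vmul (vmul x A) B = vmul x (A *m B).
Proof.
apply/rowP=> j; rewrite !mxE.
under eq_bigr => i _ do rewrite mxE scaler_sumr.
rewrite exchange_big; apply: eq_bigr => l _ /=.
rewrite mxE -[X in _ = X *: _]/((\sum_i (A l i * B i j)) : R^c) scaler_suml.
by apply: eq_bigr => i _; rewrite scalerA.
Qed.

Lemma map_vmul (G : lmodType R^c) (f : {linear F -> G}) a b
    (x : 'rV[F]_a) (A : 'M[R]_(a, b)) :
  map_mx f (vmul x A) = vmul (map_mx f x) A.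
Proof.
apply/rowP=> j; rewrite !mxE linear_sum.
by apply: eq_bigr => i _; rewrite linearZ mxE.
Qed.

End Vmul.

Lemma vmulE (R : pzRingType) a b (x : 'rV[R]_a) (A : 'M[R]_(a, b)) :
  vmul (x : 'rV[(R^c)^o]_a) A = x *m A.
Proof. by apply/rowP=> j; rewrite !mxE. Qed.

Lemma map_mx_lift (U V : Type) (f : U -> V) (P : V -> Prop) a (x : 'rV[V]_a) :
  (forall v, P v -> exists u, v = f u) -> (forall i, P (x 0 i)) ->
  exists u : 'rV[U]_a, x = map_mx f u.
Proof.
move=> fP xP; have [u uE] := choice (fun i => fP _ (xP i)).
by exists (\row_i u i); apply/rowP=> i; rewrite !mxE uE.
Qed.

(** Induction on the number i of coordinates that may be nonzero: the last of these entries form a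
    left ideal, and subtracting lifts of its generators leaves one coordinate fewer. *)
Lemma noetherian_rowspan (S : pzRingType) (noeS : noetherian_module S^o) n
    (T : {pred 'rV[S]_n}) :
  GRing.submod_closed T ->
  exists a (A : 'M[S]_(a, n)), forall x, x \in T <-> exists w, x = w *m A.
Proof.
suff gen i : forall T : {pred 'rV[S]_n}, GRing.submod_closed T ->
    (forall x, x \in T -> forall j : 'I_n, (i <= j)%N -> x 0 j = 0) ->
    exists a (A : 'M[S]_(a, n)), forall x, x \in T <-> exists w, x = w *m A.
  by move=> Tc; apply: (gen n) => // x _ j; rewrite leqNgt ltn_ord.
elim: i => [|i IHi] {}T [T0 Tlin] Tz.
  exists 0%N, 0 => x; split=> [xT|[w ->]]; last by rewrite mulmx0.
  by exists 0; rewrite mulmx0; apply/rowP=> j; rewrite mxE Tz.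
have Tsum (I : finType) (c : I -> S) (t : I -> 'rV[S]_n) :
    (forall l, t l \in T) -> \sum_l c l *: t l \in T.
  move=> tT; apply: (big_ind (fun x => x \in T)) => // [x y xT yT|l _].
    by rewrite -[x]scale1r; apply: Tlin.
  by rewrite -[X in X \in T]addr0; apply: Tlin.
have [lt_in|le_ni] := ltnP i n; last first.
  apply: IHi => // x xT j le_ij; have := ltn_ord j.
  by rewrite ltnNge (leq_trans le_ni).
pose j0 := Ordinal lt_in.
pose L : {pred S^o} := fun c => `[< exists2 x, x \in T & x 0 j0 = c >].
have Lc : GRing.submod_closed L.
  split=> [|c _ _ /asboolP[x xT <-] /asboolP[y yT <-]]; apply/asboolP.
    by exists 0; rewrite ?mxE.
  by exists (c *: x + y); [apply: Tlin | rewrite !mxE].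
have [m [g [gL genL]]] := noeS _ Lc.
have /choice[t tP] l : exists t : 'rV[S]_n, t \in T /\ t 0 j0 = g l.
  by have /asboolP[x xT xg] := gL l; exists x.
pose T' : {pred 'rV[S]_n} := fun x => (x \in T) && `[< x 0 j0 = 0 >].
have T'P x : x \in T' <-> x \in T /\ x 0 j0 = 0.
  split=> [/andP[xT /asboolP]|[xT x0]] //.
  by apply/andP; split=> //; apply/asboolP.
have [||b [B BP]] := IHi T'.
- split=> [|c x y /T'P[xT x0] /T'P[yT y0]]; apply/T'P; rewrite ?mxE //.
  by rewrite x0 y0 mulr0 addr0; split=> //; apply: Tlin.
- move=> x /T'P[xT x0] j; rewrite leq_eqVlt => /predU1P[eq_ij|]; last exact: Tz.
  by rewrite -x0; congr (x _ _); apply: val_inj.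
exists (m + b)%N, (col_mx (\matrix_l t l) B) => x.
have rowsE (c : 'rV[S]_m) : c *m (\matrix_l t l) = \sum_l c 0 l *: t l.
  by rewrite mulmx_sum_row; apply: eq_bigr => l _; rewrite rowK.
split=> [xT|[w ->]].
  have [|c xc] := genL (x 0 j0); first by apply/asboolP; exists x.
  have /BP[w wE] : x - (\row_l c l) *m (\matrix_l t l) \in T'.
    apply/T'P; rewrite rowsE; split.
      rewrite addrC -scaleN1r; apply: Tlin => //.
      by apply: Tsum => l; case: (tP l).
    rewrite !mxE xc summxE; apply/eqP; rewrite subr_eq0; apply/eqP.
    by apply: eq_bigr => l _; rewrite !mxE (tP l).2.
  exists (row_mx (\row_l c l) w).
  by rewrite mul_row_col -wE addrC subrK.
rewrite -[w]hsubmxK mul_row_col rowsE -[X in X \in T]scale1r scalerDr scale1r.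
rewrite -[X in X + _]scale1r; apply: Tlin.
  by apply: Tsum => l; case: (tP l).
rewrite scale1r; suff /T'P[] : rsubmx w *m B \in T' by [].
by apply/BP; exists (rsubmx w).
Qed.

Lemma row_syzygy (S : pzRingType) (noeS : noetherian_module S^o) b c
    (B : 'M[S]_(b, c)) :
  exists a (A : 'M[S]_(a, b)), row_exact A B.
Proof.
pose T : {pred 'rV[S]_b} := fun x => x *m B == 0.
have [|a [A AP]] := noetherian_rowspan noeS (T := T).
  split=> [|d x y /eqP xB /eqP yB]; apply/eqP; rewrite ?mul0mx //.
  by rewrite mulmxDl -scalemxAl xB yB scaler0 addr0.
exists a, A; split=> [|x xB]; last by apply/AP/eqP.
apply/row_matrixP=> i; rewrite row_mul row0 rowE; apply/eqP/AP.
by exists (delta_mx 0 i).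
Qed.

Lemma row_exact_tr (R : pzRingType) a b c (A : 'M[R^c]_(a, b))
    (B : 'M[R^c]_(b, c)) :
  row_exact A B -> col_exact (B^T : 'M[R]_(c, b)) (A^T : 'M[R]_(b, a)).
Proof.
move=> [AB kerB]; split.
  by apply: trmx_inj; rewrite trmx_mul_rev trmx0 !trmxK; exact: AB.
move=> y By; have [|w wE] := kerB (y^T : 'rV[R^c]_b).
  have := congr1 trmx By; rewrite trmx_mul_rev trmx0 trmxK; exact.
exists (w^T : 'cV[R]_a); apply: trmx_inj; rewrite trmx_mul_rev !trmxK.
exact: wE.
Qed.

Lemma col_syzygy (R : pzRingType) (noeR : right_noetherian R) b c
    (B : 'M[R]_(b, c)) :
  exists d (D : 'M[R]_(c, d)), col_exact B D.
Proof.
have [d [D /row_exact_tr DB]] := row_syzygy noeR (B^T : 'M[R^c]_(c, b)).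
by exists d, (D^T : 'M[R]_(c, d)); rewrite trmxK in DB.
Qed.

Lemma noetherian_right_ideal (R : pzRingType) (noeR : right_noetherian R)
    (J : {pred R}) :
  0 \in J -> (forall a b c, a \in J -> b \in J -> a * c + b \in J) ->
  exists q (B : 'rV[R]_q),
    forall a, a \in J <-> exists z : 'cV[R]_q, a%:M = B *m z.
Proof.
move=> J0 Jlin; have [|m [g [gJ genJ]]] := noeR (J : {pred (R^c)^o}).
  by split=> [|c a b aJ bJ]; [|apply: (Jlin a b c)].
exists m, (\row_l g l) => a; split=> [/genJ[c ->]|[z /matrixP/(_ 0 0)]].
  exists (\col_l c l); apply/matrixP=> i j; rewrite !ord1 !mxE eqxx mulr1n.
  by apply: eq_bigr => l _; rewrite !mxE.
rewrite !mxE eqxx mulr1n => ->.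
apply: (big_ind (fun x => x \in J)) => // [x y xJ yJ|l _].
  by rewrite -[x]mulr1; apply: Jlin.
by rewrite !mxE -[_ * _]addr0; apply: Jlin.
Qed.

Lemma col_exact_mx (R : pzRingType) a b c n (A : 'M[R]_(a, b))
    (B : 'M[R]_(b, c)) (Y : 'M[R]_(b, n)) :
  col_exact A B -> A *m Y = 0 -> exists Z, Y = B *m Z.
Proof.
move=> [_ kerA] AY.
have [j|z zE] := choice (fun j => kerA (col j Y) _).
  by rewrite colE mulmxA AY mul0mx.
exists (\matrix_(i, j) z j i 0); apply/matrixP=> i j.
have /matrixP/(_ i 0) := zE j; rewrite !mxE => ->.
by apply: eq_bigr => l _; rewrite !mxE.
Qed.

Lemma row_exact_mx (R : pzRingType) a b c n (A : 'M[R]_(a, b))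
    (B : 'M[R]_(b, c)) (X : 'M[R]_(n, b)) :
  (forall x : 'rV[R]_b, x *m B = 0 -> exists w : 'rV[R]_a, x = w *m A) ->
  X *m B = 0 -> exists W, X = W *m A.
Proof.
move=> kerB XB.
have [i|w wE] := choice (fun i => kerB (row i X) _).
  by rewrite -row_mul XB row0.
exists (\matrix_i w i); apply/row_matrixP=> i.
by rewrite row_mul rowK wE.
Qed.

(** * Injective coresolutions *)

Section LinearMaps.
Variable R : pzRingType.

Definition linear_of (U V : lmodType R) (f : U -> V) (lf : linear f) :
    {linear U -> V} :=
  HB.pack f (GRing.isLinear.Build R U V *:%R f lf).

Lemma linear_factor (U V N : lmodType R) (p : {linear U -> V})
    (g : {linear U -> N}) :
  (forall v, exists u, p u = v) -> (forall u, p u = 0 -> g u = 0) ->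
  exists h : {linear V -> N}, forall u, h (p u) = g u.
Proof.
move=> /choice[s sK] kerg.
have gE u u' : p u = p u' -> g u = g u'.
  move=> e; apply/eqP; rewrite -subr_eq0 -linearB; apply/eqP/kerg.
  by rewrite linearB e subrr.
have lh : linear (g \o s).
  move=> c v w /=; rewrite -linearP; apply: gE.
  by rewrite sK linearP !sK.
by exists (linear_of lh) => u; apply: gE; rewrite sK.
Qed.

Fact row_lin_fun_linear (M : lmodType R) n (g : 'I_n -> M) :
  linear (fun x : 'rV[R]_n => \sum_i x 0 i *: g i).
Proof.
move=> c x y; rewrite scaler_sumr -big_split; apply: eq_bigr => i _.
by rewrite /= !mxE scalerDl scalerA.
Qed.

Definition row_lin (M : lmodType R) n (g : 'I_n -> M) :
    {linear 'rV[R]_n -> M} :=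
  linear_of (row_lin_fun_linear g).

Lemma row_linE (M : lmodType R) n (f : {linear 'rV[R]_n -> M}) x :
  f x = row_lin (fun i => f (delta_mx 0 i)) x.
Proof.
rewrite {1}[x]row_sum_delta linear_sum; apply: eq_bigr => i _.
by rewrite linearZ.
Qed.

Lemma row_lin_delta (M : lmodType R) n (g : 'I_n -> M) i :
  row_lin g (delta_mx 0 i) = g i.
Proof.
rewrite /row_lin /= (bigD1 i) //= mxE !eqxx scale1r big1 ?addr0 //.
move=> j /negPf ji.
by rewrite mxE ji andbF scale0r.
Qed.

Lemma projective_row n : projective_module ('rV[R]_n : lmodType R).
Proof.
move=> B C p g psurj.
have /choice[b bE] i : exists b, p b = g (delta_mx 0 i) by apply: psurj.
exists (row_lin b) => x; rewrite [RHS]row_linE linear_sum.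
by apply: eq_bigr => i _; rewrite linearZ bE.
Qed.

End LinearMaps.

(** A map from columns to I that vanishes on the kernel of A factors through the image of A, and
    injectivity extends it to all columns. *)
Lemma injective_vmul (R : pzRingType) (I : lmodType R^c) a b
    (A : 'M[R]_(a, b)) (x : 'rV[I]_b) :
  injective_module I ->
  (forall y : 'cV[R]_b, A *m y = 0 -> vmul x y = 0) ->
  exists z : 'rV[I]_a, x = vmul z A.
Proof.
(* The column image of A is the row span of its transpose over [R^c]. *)
move=> injI xA; pose At : 'M[R^c]_(b, a) := A^T.
pose p0 (w : 'rV[R^c]_b) : submodule (rowspan At) :=
  exist _ (w *m At) (mem_rowspan At w).
have lp : linear p0.
  by move=> c u v; apply: val_inj; rewrite linearP /= mulmxDl scalemxAl.
have [||g gE] := linear_factor (p := linear_of lp)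
    (g := row_lin (fun i => x 0 i)).
- move=> [v vA]; have /rowspanP[w wE] := vA; exists w; apply: val_inj.
  by rewrite /= wE.
- move=> w /(congr1 val) /= wA.
  have /matrixP/(_ 0 0) : vmul x (w^T : 'cV[R]_b) = 0.
    apply: xA; apply: (@trmx_inj R); rewrite trmx_mul_rev trmx0 !trmxK.
    exact: wA.
  rewrite !mxE => e; rewrite -[RHS]e /row_lin /=.
  by apply: eq_bigr => i _; rewrite mxE.
have lv := submodule_val_linear (T := rowspan At).
have [h hE] := injI _ _ (linear_of lv) g val_inj.
exists (\row_i h (delta_mx 0 i)); apply/rowP=> j.
have := gE (delta_mx 0 j); rewrite row_lin_delta => <-.
rewrite -hE row_linE mxE; apply: eq_bigr => i _ /=.
by rewrite -rowE !mxE.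
Qed.

(* M is placed in degree 0, so that degree i.+1 holds the i-th term of I. *)
Section Augmented.
Variables (S : pzRingType) (C : lmodType S -> Prop) (M : lmodType S).
Variable I : coresolution C M.

Definition aug_obj (s : nat) : lmodType S :=
  if s is s'.+1 then I s' else M.

Definition aug_d (s : nat) : {linear aug_obj s -> aug_obj s.+1} :=
  match s with 0%N => cores_aug I | s'.+1 => cores_d I s' end.

Lemma aug_exact s (x : aug_obj s.+1) :
  aug_d s.+1 x = 0 <-> exists y, aug_d s y = x.
Proof. by case: s x => [|s] x; [apply: cores_exact0 | apply: cores_exactS]. Qed.

Lemma aug_dd s (x : aug_obj s) : aug_d s.+1 (aug_d s x) = 0.
Proof. by apply/aug_exact; exists x. Qed.

Lemma aug_dd_mx s n (x : 'rV[aug_obj s]_n) :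
  map_mx (aug_d s.+1) (map_mx (aug_d s) x) = 0.
Proof. by apply/rowP=> i; rewrite !mxE aug_dd. Qed.

Lemma aug_exact_mx s n (x : 'rV[aug_obj s.+1]_n) :
  map_mx (aug_d s.+1) x = 0 -> exists y, x = map_mx (aug_d s) y.
Proof.
move=> dx; apply: (@map_mx_lift _ _ _ (fun v => aug_d s.+1 v = 0)) => [v|i].
  by move/aug_exact=> [y yE]; exists y.
by have /rowP/(_ i) := dx; rewrite !mxE.
Qed.

End Augmented.

Section DimensionShift.
Variables (R : pzRingType).
Variable I : coresolution (@injective_module R^c) (R^c)^o.
Local Notation X := (aug_obj I).
Local Notation d := (aug_d I).

(* The cokernel of the column map of A has no first extension by the s-th     *)
(* cosyzygy of R, when A and B form an exact sequence of columns.             *)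
Definition cosyzygy_lift s a b c (A : 'M[R]_(a, b)) (B : 'M[R]_(b, c)) : Prop :=
  forall z : 'rV[X s]_b, vmul (map_mx (d s) z) B = 0 ->
  exists v : 'rV[X s]_a, map_mx (d s) z = vmul (map_mx (d s) v) A.

(** Injectivity factors [d z] through B as [z']. The image of [z'] in the next cosyzygy kills B, so
    it comes from some v through A; then [z'] minus [v] times A lies in the s-th cosyzygy and still
    factors [d z]. *)
Lemma cosyzygy_lift_down s n a b c (A : 'M[R]_(n, a)) (B : 'M[R]_(a, b))
    (C : 'M[R]_(b, c)) :
  A *m B = 0 -> col_exact B C ->
  cosyzygy_lift s.+1 A B -> cosyzygy_lift s B C.
Proof.
move=> AB [BC kerB] liftAB z zC.
have [||z' z'E] := @injective_vmul R (X s.+1) _ _ B (map_mx (d s) z).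
- exact: cores_class.
- by move=> y /kerB[w ->]; rewrite -vmulA zC vmul0l.
have [|v vE] := liftAB z'; first by rewrite -map_vmul -z'E aug_dd_mx.
have [|w wE] := @aug_exact_mx _ _ _ I s _ (z' - vmul v A).
  by rewrite map_mxB vE map_vmul subrr.
exists w; rewrite z'E -wE vmulBl.
by rewrite [vmul (vmul v A) B]vmulA AB vmul0r subr0.
Qed.

(** Here z times B is [d u], and lifting [d u] corrects z by some [d v] so that it kills B;
    injectivity then factors the difference through A. *)
Lemma cosyzygy_lift_up s n a b c (A : 'M[R]_(n, a)) (B : 'M[R]_(a, b))
    (C : 'M[R]_(b, c)) :
  col_exact A B -> B *m C = 0 ->
  cosyzygy_lift s B C -> cosyzygy_lift s.+1 A B.
Proof.
move=> [AB kerA] BC liftBC z zB.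
have [|u uE] := @aug_exact_mx _ _ _ I s _ (vmul z B).
  by rewrite map_vmul.
have [|v vE] := liftBC u; first by rewrite -uE vmulA BC vmul0r.
have [||w wE] := @injective_vmul R (X s.+1) _ _ A (z - map_mx (d s) v).
- exact: cores_class.
- move=> y /kerA[y' ->]; rewrite -vmulA vmulBl uE vE subrr.
  exact: vmul0l.
exists w; rewrite -map_vmul -wE map_mxB.
by rewrite [map_mx _ (map_mx _ v)]aug_dd_mx subr0.
Qed.

Lemma cosyzygy_lift0 a b c (A : 'M[R]_(a, b)) (B : 'M[R]_(b, c)) :
  cosyzygy_lift 0 A B <->
  forall f : 'rV[R]_b, f *m B = 0 -> exists g : 'rV[R]_a, f = g *m A.
Proof.
have inj n (x y : 'rV[X 0]_n) : map_mx (d 0) x = map_mx (d 0) y -> x = y.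
  move=> e; apply/rowP=> i; apply: (@cores_aug_inj _ _ _ I).
  by have /rowP/(_ i) := e; rewrite !mxE.
split=> lift f fB.
  have [|g gE] := lift (f : 'rV[X 0]_b); last first.
    by exists g; rewrite -vmulE; apply: inj; rewrite gE map_vmul.
  rewrite -map_vmul [vmul _ _]vmulE fB.
  by apply/rowP=> i; rewrite !mxE linear0.
have [|g gE] := lift (f : 'rV[R]_b).
  rewrite -vmulE; apply: inj; rewrite map_vmul fB.
  by apply/rowP=> i; rewrite !mxE linear0.
by exists (g : 'rV[X 0]_a); rewrite -map_vmul; congr map_mx; rewrite [RHS]vmulE.
Qed.

End DimensionShift.

(** * Flat modules *)

Section TensorTheory.
Variables (R : pzRingType) (I : lmodType R^c) (M : lmodType R).

Lemma tensor_piB : {morph @tensor_pi R I M : u v / u - v}.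
Proof. by move=> u v; rewrite /tensor_pi !piE. Qed.

Lemma tensor_pi_eq0 u : @tensor_pi R I M u = 0 <-> tensor_rel u.
Proof.
have <- : @tensor_pi R I M 0 = 0 by rewrite -[0](subrr 0) tensor_piB subrr.
have <- : (u - 0 \in @tensor_relb R I M) <-> tensor_rel u.
  by rewrite subr0; split=> [/asboolP|uR] //; apply/asboolP.
rewrite Quotient.idealrBE /tensor_pi; split; first by move=> ->.
by move/eqP.
Qed.

HB.instance Definition _ := GRing.isZmodMorphism.Build
  {freeg (I * M)%type} (tensor I M) (@tensor_pi R I M) tensor_piB.

Lemma tensor_eltDl x y m :
  @tensor_elt R I M (x + y) m = tensor_elt x m + tensor_elt y m.
Proof.
have /tensor_pi_eq0/eqP := tensor_relDl x y m.
by rewrite !raddfB /= !subr_eq add0r => /eqP e; rewrite [RHS]addrC.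
Qed.

Lemma tensor_eltDr x m n :
  @tensor_elt R I M x (m + n) = tensor_elt x m + tensor_elt x n.
Proof.
have /tensor_pi_eq0/eqP := tensor_relDr x m n.
by rewrite !raddfB /= !subr_eq add0r => /eqP e; rewrite [RHS]addrC.
Qed.

Lemma tensor_eltZ x (a : R) m :
  @tensor_elt R I M ((a : R^c) *: x) m = tensor_elt x (a *: m).
Proof.
apply/eqP; rewrite -subr_eq0 /tensor_elt -raddfB.
by apply/eqP/tensor_pi_eq0/tensor_relZ.
Qed.

Lemma tensor_elt0l m : @tensor_elt R I M 0 m = 0.
Proof. by apply: (addrI (tensor_elt 0 m)); rewrite -tensor_eltDl !addr0. Qed.

Lemma tensor_elt0r x : @tensor_elt R I M x 0 = 0.
Proof. by apply: (addrI (tensor_elt x 0)); rewrite -tensor_eltDr !addr0. Qed.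

Lemma tensor_elt_suml J (r : seq J) (x : J -> I) m :
  @tensor_elt R I M (\sum_(j <- r) x j) m = \sum_(j <- r) tensor_elt (x j) m.
Proof.
by apply: (big_morph (fun x => tensor_elt x m)) => [y z|];
  rewrite ?tensor_eltDl ?tensor_elt0l.
Qed.

Lemma tensor_elt_sumr J (r : seq J) x (m : J -> M) :
  @tensor_elt R I M x (\sum_(j <- r) m j) = \sum_(j <- r) tensor_elt x (m j).
Proof.
by apply: big_morph => [y z|]; rewrite ?tensor_eltDr ?tensor_elt0r.
Qed.

End TensorTheory.

(** Exactness embeds [coker A] into free rows, so by flatness the tensor [u] built from x is zero;
    it remains to map the tensor relations back to rows over F. *)
Lemma flat_row_exact (R : pzRingType) (F : lmodType R^c) a b c
    (A : 'M[R]_(a, b)) (B : 'M[R]_(b, c)) (x : 'rV[F]_b) :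
  flat_right_module F -> row_exact A B -> vmul x B = 0 ->
  exists w : 'rV[F]_a, x = vmul w A.
Proof.
move=> flatF [AB kerB] xB.
have [||f fE] := linear_factor (p := @coker_pi R a b A : {linear _ -> _})
    (g := mulmxr B : {linear 'rV[R]_b -> 'rV[R]_c}).
- by move=> m; exists (coker_repr m); apply: coker_reprK.
- by move=> u /coker_pi0/rowspanP[w ->]; rewrite /= -mulmxA AB mulmx0.
have f_inj : injective f.
  move=> m n; rewrite -(coker_reprK m) -(coker_reprK n) !fE /= => /eqP.
  rewrite -subr_eq0 -mulmxBl => /eqP/kerB[w wE].
  by apply/coker_pi_eq; rewrite wE mem_rowspan.
pose u := \sum_i << (x 0 i, coker_pi A (delta_mx 0 i)) >> :
  {freeg (F * coker A)%type}.
have uR : tensor_rel u.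
  apply/tensor_pi_eq0/(flatF _ _ _ f_inj).
  have -> : 0 = @tensor_pi R F (coker A) 0 by rewrite raddf0.
  rewrite !tensor_map_pi !raddf0 !raddf_sum /=.
  under eq_bigr => i _.
    rewrite freeg_mapU /= fE /= -rowE [row i B]row_sum_delta.
    rewrite -/(tensor_elt _ _) tensor_elt_sumr.
    under eq_bigr => j _ do rewrite -tensor_eltZ mxE.
    over.
  rewrite exchange_big big1 // => j _.
  rewrite /= -tensor_elt_suml; have /rowP/(_ j) := xB; rewrite !mxE => ->.
  exact: tensor_elt0l.
pose im (v : 'rV[F]_b) := exists w : 'rV[F]_a, v = vmul w A.
have imB v w : im v -> im w -> im (v - w).
  by move=> [v' ->] [w' ->]; exists (v' - w'); rewrite vmulBl.
have im0 : im 0 by exists 0; rewrite vmul0l.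
have im_pi (y : F) r s : coker_pi A r = coker_pi A s ->
    im (vmul (const_mx y : 'rV[F]_1) (r - s)).
  move/coker_pi_eq/rowspanP=> [w ->].
  by rewrite -vmulA; exists (vmul (const_mx y) w).
(* Coset representatives make [h] biadditive and balanced only modulo [im], which is enough: each
   defining relation lands in [im]. *)
pose h (p : F * coker A) : zmodule 'rV[F]_b :=
  vmul (const_mx p.1 : 'rV[F]_1) (coker_repr p.2).
have [L LU] : exists L : {additive {freeg (F * coker A)%type} -> 'rV[F]_b},
    forall q, L << q >> = h q.
  pose L : {additive {freeg (F * coker A)%type} -> 'rV[F]_b} :=
    HB.pack (fglift h : _ -> 'rV[F]_b)
      (GRing.isZmodMorphism.Build _ _ _ (lift_is_additive h)).
  by exists L => q; rewrite [LHS]liftU scale1r.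
have im_lift v : tensor_rel v -> im (L v).
  elim=> [|{}v w _ vI _ wI|y z m|y m n|y r m].
  - by rewrite raddf0.
  - by rewrite raddfB; apply: imB.
  - rewrite !raddfB /= !LU /h /=.
    have -> : const_mx (y + z) = const_mx y + const_mx z :> 'rV[F]_1.
      by apply/rowP=> i; rewrite !mxE.
    by rewrite -!vmulBl [const_mx y + _]addrC addrK subrr vmul0l.
  - rewrite !raddfB /= !LU /h /=.
    rewrite -!vmulBr -addrA -opprD; apply: im_pi.
    by rewrite coker_piD !coker_reprK.
  rewrite !raddfB /= !LU /h /=.
  have -> : const_mx ((r : R^c) *: y) = vmul (const_mx y : 'rV[F]_1) r%:M.
    by apply/rowP=> i; rewrite !mxE big_ord1 !ord1 !mxE eqxx.
  rewrite vmulA mul_scalar_mx -vmulBr.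
  by apply: im_pi; rewrite linearZ /= !coker_reprK.
have imD v w : im v -> im w -> im (v + w).
  by move=> vI wI; rewrite -[w]opprK -[- w]sub0r; do 2!apply: (imB) => //.
have -> : x = \sum_i vmul (const_mx (x 0 i) : 'rV[F]_1) (delta_mx 0 i).
  apply/rowP=> j; rewrite summxE (bigD1 j) //= !mxE big_ord1 !mxE !eqxx scale1r.
  rewrite big1 ?addr0 // => i /negPf ij; rewrite !mxE big_ord1 !mxE.
  by rewrite [j == i]eq_sym ij scale0r.
have := im_lift _ uR; rewrite raddf_sum /=.
under eq_bigr => i _ do rewrite LU /h /=.
move=> imu; rewrite -/(im _) -[X in im X](subrK (\sum_i
  vmul (const_mx (x 0 i) : 'rV[F]_1) (coker_repr (coker_pi A (delta_mx 0 i))))).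
apply: (imD) => //; rewrite -sumrB; apply: (big_ind im im0 imD) => i _.
by rewrite -vmulBr; apply: im_pi; rewrite coker_reprK.
Qed.

(* Tor_(t+1) vanishes against a right module of flat dimension at most t; the *)
(* two resolutions are chased simultaneously. *)
Lemma flat_dim_row_exact (R : pzRingType) (F : lmodType R^c) (p : nat -> nat)
    (A : forall i, 'M[R]_(p i.+1, p i)) t n (x : 'rV[F]_(p t.+1)) :
  flat_dim_right_le F n -> (n <= t)%N ->
  (forall i, row_exact (A i.+1) (A i)) -> vmul x (A t) = 0 ->
  exists w : 'rV[F]_(p t.+2), x = vmul w (A t.+1).
Proof.
move=> [G Gn] le_nt exA xA.
(* The walk keeps s + u fixed; at u = 0 the element z lives in a term of G that vanishes. *)
have chase u s : (forall i, (s + u < i)%N -> forall y : G i, y = 0) ->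
    forall (y : 'rV[G s]_(p u.+1)) (z : 'rV[G s.+1]_(p u)),
    vmul y (A u) = map_mx (res_d G s) z ->
    exists v w, y = map_mx (res_d G s) v + vmul w (A u.+1).
  elim: u s => [|u IHu] s Gsu y z yz.
    have [|w wE] := flat_row_exact (res_class G s) (exA 0%N) (x := y).
      rewrite yz; apply/rowP=> i; rewrite !mxE.
      by rewrite [z 0 i]Gsu ?linear0 // addn0.
    exists 0, w; rewrite wE; apply/rowP=> i; rewrite [in RHS]mxE.
    by rewrite [in RHS]mxE [in RHS]mxE linear0 add0r.
  have dzA : map_mx (res_d G s) (vmul z (A u)) = 0.
    by rewrite map_vmul -yz vmulA (exA u).1 vmul0r.
  have [|i|z' z'E] := @map_mx_lift _ _ (res_d G s.+1) (fun v => res_d G s v = 0)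
      _ (vmul z (A u)).
  - by move=> v /res_exactS[v' <-]; exists v'.
  - by have /rowP/(_ i) := dzA; rewrite !mxE.
  have [|v' [w' zE]] := IHu s.+1 _ z z' z'E; first by rewrite addSnnS.
  have [|w wE] := flat_row_exact (res_class G s) (exA u.+1)
      (x := y - map_mx (res_d G s) w').
    rewrite vmulBl yz zE map_mxD map_vmul.
    have -> : map_mx (res_d G s) (map_mx (res_d G s.+1) v') = 0.
      by apply/rowP=> i; rewrite !mxE; apply/res_exactS; exists (v' 0 i).
    by rewrite add0r subrr.
  by exists w', w; rewrite -wE addrC subrK.
have [||y yE] := @map_mx_lift _ _ (res_aug G) (fun=> True) _ x.
- by move=> v _; have [v' <-] := res_aug_surj G v; exists v'.
- by [].
have [|i|z zE] := @map_mx_lift _ _ (res_d G 0) (fun v => res_aug G v = 0)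
    _ (vmul y (A t)).
- by move=> v /res_exact0[v' <-]; exists v'.
- have /rowP/(_ i) := xA; rewrite yE -map_vmul => e.
  by rewrite mxE in e; rewrite e mxE.
have [|v [w yvw]] := chase t 0%N _ y z zE.
  by move=> i lt_ti; apply: Gn; apply: leq_ltn_trans lt_ti.
exists (map_mx (res_aug G) w); rewrite yE yvw map_mxD map_vmul.
have -> : map_mx (res_aug G) (map_mx (res_d G 0) v) = 0.
  by apply/rowP=> i; rewrite !mxE; apply/res_exact0; exists (v 0 i).
by rewrite add0r.
Qed.

(** * Resolutions *)

Section Resolutions.
Variable S : pzRingType.

(** Dimension sequences built this way have first terms that compute, so that [A 0] and a given
    matrix can be equated without casts. *)
Definition scons (T : Type) (x : T) (f : nat -> T) (i : nat) : T :=
  if i is j.+1 then f j else x.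

Lemma row_resolution (noeS : noetherian_module S^o) b c (B : 'M[S]_(b, c)) :
  exists p (A : forall i, 'M[S]_(scons c (scons b p) i.+1,
                                 scons c (scons b p) i)),
    A 0%N = B /\ forall i, row_exact (A i.+1) (A i).
Proof.
pose T := {m & {n & 'M[S]_(m, n)}}.
pose mx (t : T) := projT2 (projT2 t).
have next (t : T) : {a & {A : 'M[S]_(a, projT1 t) | row_exact A (mx t)}}.
  have [a /cid ?] := cid (row_syzygy noeS (mx t)); by exists a.
pose f i : T := iter i (fun t => existT _ (projT1 (next t))
  (existT _ (projT1 t) (sval (projT2 (next t))))) (existT _ b (existT _ c B)).
pose q := scons c (scons b (fun i => projT1 (f i.+1))).
pose A i : 'M[S]_(q i.+1, q i) := match i return 'M[S]_(q i.+1, q i) with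
  | 0%N => B | 1%N => mx (f 1%N) | j.+2 => mx (f j.+2) end.
exists (fun i => projT1 (f i.+1)), A.
split=> // -[|[|i]]; first exact: (svalP (projT2 (next (f 0%N)))).
  exact: (svalP (projT2 (next (f 1%N)))).
exact: (svalP (projT2 (next (f i.+2)))).
Qed.

(** Projectivity is applied after cutting Y down to the image of g. *)
Lemma projective_lift (P X Y : lmodType S) (f : {linear P -> Y})
    (g : {linear X -> Y}) :
  projective_module P -> (forall x, exists y, g y = f x) ->
  exists h : {linear P -> X}, forall x, g (h x) = f x.
Proof.
move=> projP fg; pose T : {pred Y} := fun y => `[< exists x, g x = y >].
have Tc : GRing.submod_closed T.
  split=> [|c _ _ /asboolP[x <-] /asboolP[y <-]]; apply/asboolP.
    by exists 0; rewrite linear0.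
  by exists (c *: x + y); rewrite linearP.
pose T' : submodClosed Y := HB.pack T (GRing.isSubmodClosed.Build S Y T Tc).
have gT x : g x \in T' by apply/asboolP; exists x.
have fT x : f x \in T' by apply/asboolP; apply: fg.
have lg : linear (fun x => exist _ (g x) (gT x) : submodule T').
  by move=> c x y; apply: val_inj; rewrite /= linearP.
have lf : linear (fun x => exist _ (f x) (fT x) : submodule T').
  by move=> c x y; apply: val_inj; rewrite /= linearP.
have [|h hE] := projP _ _ (linear_of lg) (linear_of lf).
  by move=> [y yT]; have /asboolP[x xE] := yT; exists x; apply: val_inj.
by exists h => x; have /(congr1 val) := hE x.
Qed.

Variable M : lmodType S.
Implicit Types P Q : resolution (@projective_module S) M.

Lemma res_dd P i x : res_d P i (res_d P i.+1 x) = 0.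
Proof. by apply/res_exactS; exists x. Qed.

Lemma comparison P Q :
  exists al : forall i, {linear P i -> Q i},
    (forall x, res_aug Q (al 0%N x) = res_aug P x) /\
    forall i x, res_d Q i (al i.+1 x) = al i (res_d P i x).
Proof.
have [|a0 a0E] := projective_lift (f := res_aug P) (g := res_aug Q)
    (res_class P 0).
  by move=> x; apply: res_aug_surj.
pose sq i (a : {linear P i -> Q i}) (b : {linear P i.+1 -> Q i.+1}) :=
  forall x, res_d Q i (b x) = a (res_d P i x).
have [|a1 a1E] := projective_lift (f := a0 \o res_d P 0) (g := res_d Q 0)
    (res_class P 1).
  move=> x; apply/res_exact0; rewrite a0E.
  by apply/res_exact0; exists x.
have next i a b : sq i a b -> {c | sq i.+1 b c}.
  move=> ab; apply: cid.
  have [|c cE] := projective_lift (f := b \o res_d P i.+1) (g := res_d Q i.+1)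
      (res_class P i.+2); last by exists c.
  by move=> x; apply/res_exactS; rewrite /= ab res_dd linear0.
(* The recursion carries two consecutive maps with their commuting square, from which the next map
   is chosen. *)
pose f := fix f i : {a & {b | sq i a b}} :=
  match i with
  | 0%N => existT _ a0 (exist _ a1 a1E)
  | j.+1 => let c := next j _ _ (svalP (projT2 (f j))) in
            existT _ (sval (projT2 (f j))) (exist _ (sval c) (svalP c))
  end.
exists (fun i => projT1 (f i)); split=> // i x.
exact: (svalP (projT2 (f i))).
Qed.

Lemma null_homotopy P Q (ga : forall i, {linear P i -> Q i}) :
  (forall x, res_aug Q (ga 0%N x) = 0) ->
  (forall i x, res_d Q i (ga i.+1 x) = ga i (res_d P i x)) ->
  exists h : forall i, {linear P i -> Q i.+1},
    forall i x, ga i.+1 x = res_d Q i.+1 (h i.+1 x) + h i (res_d P i x).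
Proof.
move=> ga0 gaS.
pose ok i (h : {linear P i -> Q i.+1}) :=
  forall x, res_d Q i (h (res_d P i x)) = ga i (res_d P i x).
have [|h0 h0E] := projective_lift (f := ga 0%N) (g := res_d Q 0)
    (res_class P 0).
  by move=> x; apply/res_exact0; apply: ga0.
have ok0 : ok 0%N h0 by move=> x; apply: h0E.
have next i h : ok i h -> {h' | ok i.+1 h' &
    forall x, ga i.+1 x = res_d Q i.+1 (h' x) + h (res_d P i x)}.
  move=> okh; apply: cid2.
  have [|h' h'E] := projective_lift (f := ga i.+1 \- (h \o res_d P i))
      (g := res_d Q i.+1) (res_class P i.+1).
    by move=> x; apply/res_exactS; rewrite linearB /= gaS okh subrr.
  exists h' => x; last by rewrite h'E /= subrK.
  by rewrite h'E /= res_dd linear0 subr0.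
pose f := fix f i : {h | ok i h} :=
  match i with
  | 0%N => exist _ h0 ok0
  | j.+1 => let h' := next j _ (svalP (f j)) in exist _ (s2val h') (s2valP h')
  end.
exists (fun i => sval (f i)) => i x.
exact: (s2valP' (next i _ (svalP (f i)))).
Qed.

(** One projective resolution suffices to test vanishing: the round trip Q to P to Q is homotopic to
    the identity. *)
Lemma Ext_zero_resolution (N : lmodType S) P j :
  (forall f : {linear P j.+1 -> N}, (forall x, f (res_d P j.+1 x) = 0) ->
     exists g : {linear P j -> N}, forall x, f x = g (res_d P j x)) ->
  Ext_zero j.+1 M N.
Proof.
move=> cobP Q f fd.
have [al [al0 alS]] := comparison Q P.
have [be [be0 beS]] := comparison P Q.
have [||h hE] := null_homotopy (ga := fun i => (be i \o al i) \- idfun).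
- by move=> x; rewrite linearB /= be0 al0 subrr.
- by move=> i x; rewrite linearB /= beS alS.
have [|g gE] := cobP (f \o be j.+1).
  by move=> x; rewrite /= -beS fd.
exists ((g \o al j) \- (f \o h j)) => x /=.
rewrite -alS -gE /=; have /(congr1 f) := hE j x.
rewrite /= linearB linearD fd add0r => <-.
by rewrite opprB addrC subrK.
Qed.

End Resolutions.

Lemma col_resolution (R : pzRingType) (noeR : right_noetherian R) b c
    (B : 'M[R]_(b, c)) :
  exists p (A : forall i, 'M[R]_(scons b (scons c p) i,
                                 scons b (scons c p) i.+1)),
    A 0%N = B /\ forall i, col_exact (A i) (A i.+1).
Proof.
have [p [A [A0 exA]]] := row_resolution noeR (B^T : 'M[R^c]_(c, b)).
exists p, (fun i => (A i)^T : 'M[R]__); split; first by rewrite A0 trmxK.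
by move=> i; apply: row_exact_tr.
Qed.

Lemma row_fun_col (R : pzRingType) n (f : {linear 'rV[R]_n -> R^o})
    (x : 'rV[R]_n) :
  (f x)%:M = x *m (\col_i f (delta_mx 0 i)).
Proof.
apply/matrixP=> i j; rewrite !ord1 row_linE /row_lin /= !mxE eqxx mulr1n.
by apply: eq_bigr => l _; rewrite !mxE.
Qed.

Section FreeResolution.
Variables (R : pzRingType) (M : lmodType R) (p : nat -> nat).
Variables (A : forall i, 'M[R]_(p i.+1, p i)).
Variable (pi : {linear 'rV[R]_(p 0) -> M}).
Hypothesis pi_surj : forall m, exists x, pi x = m.
Hypothesis pi_ker : forall x, pi x = 0 <-> exists w, x = w *m A 0.
Hypothesis exA : forall i, row_exact (A i.+1) (A i).

Fact free_resolution_exact0 (x : 'rV[R]_(p 0)) :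
  pi x = 0 <-> exists y : 'rV[R]_(p 1), mulmxr (A 0) y = x.
Proof. by rewrite pi_ker; split=> -[w wE]; exists w. Qed.

Fact free_resolution_exactS i (x : 'rV[R]_(p i.+1)) :
  mulmxr (A i) x = 0 <-> exists y : 'rV[R]_(p i.+2), mulmxr (A i.+1) y = x.
Proof.
have [AA kerA] := exA i; split=> [/kerA[w ->]|[y <-]]; first by exists w.
by rewrite /= -mulmxA AA mulmx0.
Qed.

Definition free_resolution : resolution (@projective_module R) M :=
  Resolution (fun i => @projective_row R (p i)) pi_surj
    free_resolution_exact0 free_resolution_exactS.

Lemma Ext_zero_freeP j :
  Ext_zero j.+1 M R^o <->
  forall y : 'cV[R]_(p j.+1), A j.+1 *m y = 0 -> exists z, y = A j *m z.
Proof.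
have lcol n (y : 'cV[R]_n) :
    linear (fun x : 'rV[R]_n => (x *m y) 0 0 : R^o).
  by move=> c u v; rewrite mulmxDl -scalemxAl !mxE.
split=> [ext y Ay|exact].
  have [|g gE] := ext free_resolution (linear_of (lcol _ y)).
    by move=> x; rewrite /= -mulmxA Ay mulmx0 mxE.
  exists (\col_i g (delta_mx 0 i)); apply/row_matrixP=> i.
  rewrite row_mul !rowE -row_fun_col.
  have /= <- := gE (delta_mx 0 i); apply/rowP=> l; rewrite !ord1 [RHS]mxE eqxx.
  by rewrite mulr1n.
apply: (Ext_zero_resolution (P := free_resolution)) => f fA.
have [|z zE] := exact (\col_i f (delta_mx 0 i)).
  apply/row_matrixP=> i; rewrite row_mul rowE -row_fun_col.
  have /= -> := fA (delta_mx 0 i).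
  by rewrite row0; apply/rowP=> l; rewrite !mxE mul0rn.
exists (linear_of (lcol _ z)) => x /=.
by rewrite -mulmxA -zE -row_fun_col mxE eqxx mulr1n.
Qed.

End FreeResolution.

(** * Reflexive modules *)

(** After n shifts the level is s + n, where the cosyzygy is zero. *)
Lemma inj_dim_cosyzygy_lift (R : pzRingType)
    (I : coresolution (@injective_module R^c) (R^c)^o) n s (p : nat -> nat)
    (A : forall i, 'M[R]_(p i.+1, p i)) :
  (forall i, (s + n < i)%N -> forall x : aug_obj I i, x = 0) ->
  (forall i, A i.+1 *m A i = 0) ->
  (forall i, (i < n)%N -> col_exact (A i.+1) (A i)) ->
  cosyzygy_lift I s (A 1) (A 0).
Proof.
elim: n s p A => [|n IHn] s p A Is AA exA.
  move=> z _; exists 0; rewrite -map_vmul vmul0l.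
  apply/rowP=> i; rewrite addn0 in Is.
  by rewrite !mxE [LHS]Is // [RHS]Is.
apply: cosyzygy_lift_down (AA 1%N) (exA 0%N isT) _.
apply: (IHn s.+1 (fun i => p i.+1) (fun i => A i.+1)) => [i lt_i|i|i lt_in].
- by apply: Is; rewrite addnS -addSn.
- exact: AA.
- exact: exA.
Qed.

Lemma scalar_mx1_inj (R : pzRingType) (a c : R) : a%:M = c%:M :> 'M_1 -> a = c.
Proof. by move/matrixP/(_ 0 0); rewrite !mxE eqxx !mulr1n. Qed.

Section Presentation.
Variables (R : pzRingType) (M : lmodType R) (n b : nat) (A : 'M[R]_(b, n)).
Variable pi : {linear 'rV[R]_n -> M}.
Hypothesis pi_surj : forall m, exists x, pi x = m.
Hypothesis pi_ker : forall x, pi x = 0 <-> exists w, x = w *m A.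

Lemma dual_of_col (z : 'cV[R]_n) :
  A *m z = 0 -> exists f : dual M, forall x, (dual_app f (pi x))%:M = x *m z.
Proof.
move=> Az; have lz : linear (fun x : 'rV[R]_n => (x *m z) 0 0 : R^o).
  by move=> c u v; rewrite mulmxDl -scalemxAl !mxE.
have [||f fE] := linear_factor (p := pi) (g := linear_of lz).
- exact: pi_surj.
- by move=> u /pi_ker[w ->]; rewrite /= -mulmxA Az mulmx0 mxE.
exists f => x; rewrite /dual_app fE /=.
by apply/matrixP=> i j; rewrite !ord1 mxE eqxx mulr1n.
Qed.

Lemma col_of_dual (f : dual M) :
  exists2 z : 'cV[R]_n, A *m z = 0 &
    forall x, (dual_app f (pi x))%:M = x *m z.
Proof.
have fE x := row_fun_col ((f : {linear M -> R^o}) \o pi) x.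
exists (\col_i dual_app f (pi (delta_mx 0 i))) => //.
apply/row_matrixP=> i; rewrite row_mul -fE /=.
have -> : pi (row i A) = 0 by apply/pi_ker; exists (delta_mx 0 i); rewrite rowE.
by rewrite linear0 row0; apply/rowP=> l; rewrite !mxE mul0rn.
Qed.

Lemma torsionlessP :
  torsionless M <->
  forall x : 'rV[R]_n, (forall z : 'cV[R]_n, A *m z = 0 -> x *m z = 0) ->
    exists w, x = w *m A.
Proof.
split=> [tM x xz|tA m m' e].
  apply/pi_ker/tM; apply: dualP => f.
  have [z Az fE] := col_of_dual f.
  apply: scalar_mx1_inj; rewrite [LHS]fE xz //.
  have -> : dual_app (@sigma R M 0) f = dual_app f (pi 0) by rewrite linear0.
  by rewrite fE mul0mx.
have [x xE] := pi_surj (m - m'); apply/eqP; rewrite -subr_eq0 -xE.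
apply/eqP/pi_ker/tA => z Az; have [f fE] := dual_of_col Az.
have emf : dual_app f m = dual_app f m' := congr1 (fun s => dual_app s f) e.
rewrite -fE xE [dual_app f _]linearB -![_ f _]/(dual_app f _) emf subrr.
by apply/matrixP=> i j; rewrite !mxE mul0rn.
Qed.

(** The columns of C generate the dual of M and those of D their relations. Hence the bidual
    consists of the rows killed by D, and [sigma] sends the class of w to [w *m C]. *)
Lemma bidual_surj c d (C : 'M[R]_(n, c)) (D : 'M[R]_(c, d)) :
  col_exact A C -> col_exact C D ->
  (forall x : 'rV[R]_c, x *m D = 0 -> exists w : 'rV[R]_n, x = w *m C) ->
  forall ph : bidual M, exists m, sigma m = ph.
Proof.
move=> [AC kerA] [CD kerC] liftC ph.
have /choice[f fE] l : exists f : dual M,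
    forall x, (dual_app f (pi x))%:M = x *m col l C.
  by apply: dual_of_col; rewrite colE mulmxA AC mul0mx.
pose comb (t : 'cV[R]_c) : dual M := \sum_l (t l 0 : R^c) *: f l.
have combE t x : (dual_app (comb t) (pi x))%:M = x *m C *m t.
  have -> : dual_app (comb t) (pi x) = \sum_l dual_app (f l) (pi x) * t l 0.
    by rewrite /comb; elim/big_rec2: _ => [//|l u v _ <-].
  apply/matrixP=> i j; rewrite !ord1 !mxE eqxx mulr1n; apply: eq_bigr => l _.
  congr (_ * _); apply: scalar_mx1_inj; rewrite fE.
  apply/matrixP=> i' j'; rewrite !ord1 !mxE eqxx mulr1n.
  by apply: eq_bigr => i'' _; rewrite mxE.
pose y : 'rV[R]_c := \row_l dual_app ph (f l).
have phE t : (dual_app ph (comb t))%:M = y *m t.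
  rewrite /dual_app [comb t]/comb linear_sum.
  apply/matrixP=> i j; rewrite !ord1 !mxE eqxx mulr1n; apply: eq_bigr => l _.
  by rewrite linearZ mxE.
have [|w wE] := liftC y.
  apply/row_matrixP=> i; apply/matrixP=> j l; rewrite row0 [RHS]mxE.
  have -> : row i (y *m D) j l = (y *m col l D) 0 0.
    by rewrite colE mulmxA -colE !mxE !ord1.
  rewrite -phE.
  have -> : comb (col l D) = 0.
    apply: dualP => m; have [x <-] := pi_surj m; apply: scalar_mx1_inj.
    rewrite combE colE mulmxA -[x *m C *m D]mulmxA CD mulmx0 mul0mx.
    by apply/matrixP=> i' j'; rewrite !mxE mul0rn.
  by rewrite /dual_app linear0 !mxE mul0rn.
exists (pi w); apply: dualP => g.
have [z /kerA[t zt] gE] := col_of_dual g.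
have -> : g = comb t.
  apply: dualP => m; have [x <-] := pi_surj m; apply: scalar_mx1_inj.
  by rewrite gE combE zt mulmxA.
by apply: scalar_mx1_inj; rewrite phE wE -combE.
Qed.

End Presentation.

Lemma fin_gen_resolution (R : pzRingType) (lnoe : left_noetherian R)
    (M : lmodType R) :
  fin_gen M ->
  exists p (A : forall i, 'M[R]_(p i.+1, p i))
      (pi : {linear 'rV[R]_(p 0) -> M}),
    [/\ forall m, exists x, pi x = m,
        forall x, pi x = 0 <-> exists w, x = w *m A 0
      & forall i, row_exact (A i.+1) (A i)].
Proof.
move=> [n [g gen]]; pose T : {pred 'rV[R]_n} := fun x => row_lin g x == 0.
have [|b [B BP]] := noetherian_rowspan lnoe (T := T).
  split=> [|c x y /eqP x0 /eqP y0]; apply/eqP; first by rewrite linear0.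
  by rewrite linearP x0 y0 scaler0 addr0.
have [p [A [A0 exA]]] := row_resolution lnoe B.
exists (scons n (scons b p)), A, (row_lin g); split=> // [m|x].
  have [c ->] := gen m; exists (\row_i c i); rewrite /row_lin /=.
  by apply: eq_bigr => i _; rewrite mxE.
by rewrite A0; split=> [/eqP/BP|/BP/eqP].
Qed.

Lemma inj_dim_reflexive (R : pzRingType) k (lnoe : left_noetherian R)
    (rnoe : right_noetherian R) (M : lmodType R) :
  inj_dim_le (R^c)^o k -> fin_gen M -> reduced_grade_ge k.+1 M ->
  reflexive_module M.
Proof.
move=> [I Ik] /(fin_gen_resolution lnoe)[p [A [pi [surj ker exA]]]] gradeM.
have [c [C AC]] := col_syzygy rnoe (A 0).
have [d [D CD]] := col_syzygy rnoe C.
(* Level 1 serves for injectivity of [sigma], level 2 for surjectivity. *)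
have lift s : cosyzygy_lift I s.+1 (A 1) (A 0).
  apply: (@inj_dim_cosyzygy_lift R I k) => [[//|i]|i|i lt_ik].
  - by rewrite addSn ltnS => /(leq_ltn_trans (leq_addl _ _)); apply: Ik.
  - exact: (exA i).1.
  split; first exact: (exA i).1.
  by apply/(Ext_zero_freeP surj ker exA)/gradeM; rewrite /= ltnS.
have AA := (exA 0%N).1.
have sigma_inj : torsionless M.
  apply/(torsionlessP surj ker) => x xz.
  have /cosyzygy_lift0 := cosyzygy_lift_down AA AC (lift 0%N).
  apply; apply/matrixP=> i j; have /xz : A 0 *m col j C = 0.
    by rewrite colE mulmxA AC.1 mul0mx.
  by rewrite colE mulmxA -colE => /matrixP/(_ i 0); rewrite !mxE.
have [|g gK] := choice (bidual_surj surj ker AC CD _).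
  apply/cosyzygy_lift0/(cosyzygy_lift_down AC.1 CD).
  exact/(cosyzygy_lift_down AA AC)/lift.
by exists g => // m; apply: sigma_inj; rewrite gK.
Qed.

(** * Reduced grade of transposed syzygies *)

Lemma vmul_row_col (R : pzRingType) (F : lmodType R^c) a1 a2 b
    (x : 'rV[F]_a1) (y : 'rV[F]_a2) (A : 'M[R]_(a1, b)) (B : 'M[R]_(a2, b)) :
  vmul (row_mx x y) (col_mx A B) = vmul x A + vmul y B.
Proof.
apply/rowP=> j; rewrite !mxE big_split_ord; congr (_ + _);
  by apply: eq_bigr => i _; rewrite ?(col_mxEu, col_mxEd) ?(row_mxEl, row_mxEr).
Qed.

Lemma vmul_mul_row (R : pzRingType) (F : lmodType R^c) a b1 b2
    (x : 'rV[F]_a) (A : 'M[R]_(a, b1)) (B : 'M[R]_(a, b2)) :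
  vmul x (row_mx A B) = row_mx (vmul x A) (vmul x B).
Proof.
apply/rowP=> j; rewrite -[j]splitK; case: (split j) => l /=;
  rewrite ?(row_mxEl, row_mxEr) !mxE; apply: eq_bigr => i _;
  by rewrite ?(row_mxEl, row_mxEr).
Qed.

Lemma cosyzygy_lift_chain (R : pzRingType)
    (I : coresolution (@injective_module R^c) (R^c)^o) (p : nat -> nat)
    (V : forall i, 'M[R]_(p i, p i.+1)) t s :
  (forall i, V i *m V i.+1 = 0) ->
  (forall i, col_exact (V i.+1) (V i.+2)) ->
  cosyzygy_lift I (s + t) (V 0) (V 1) -> cosyzygy_lift I s (V t) (V t.+1).
Proof.
move=> VV exV; elim: t s => [|t IHt] s; first by rewrite addn0.
rewrite addnS -addSn => /IHt; exact: cosyzygy_lift_down.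
Qed.

Section SyzygyGrade.
Variables (R : pzRingType) (k : nat).
Hypothesis rnoe : right_noetherian R.
Variable I : coresolution (@injective_module R^c) (R^c)^o.
Hypothesis Ifd : forall i, (i < k)%N -> flat_dim_right_le (I i) i.+1.
Variables (n : nat -> nat) (D : forall i, 'M[R]_(n i.+1, n i)).
Hypothesis DD : forall i, D i.+1 *m D i = 0.
Hypothesis exD : forall i, (i < k)%N -> col_exact (D i.+1) (D i).
Variable p : nat -> nat.
Local Notation q := (scons (n 0%N) (scons (n 1%N) p)).
Variables (A : forall i, 'M[R]_(q i.+1, q i)).
Hypothesis A0 : A 0 = D 0.
Hypothesis exA : forall i, row_exact (A i.+1) (A i).

(** D is a complex of free rows and A is exact, so the identity in degrees 0 and 1 extends to a
    chain map. *)
Lemma comparison_mx : exists C : forall i, 'M[R]_(n i, q i),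
  C 1%N = 1%:M /\ forall i, C i.+1 *m A i = D i *m C i.
Proof.
pose sq i (a : 'M[R]_(n i, q i)) (b : 'M[R]_(n i.+1, q i.+1)) :=
  b *m A i = D i *m a.
have sq0 : @sq 0%N 1%:M 1%:M by rewrite /sq mul1mx mulmx1 A0.
have next i a b : sq i a b -> {c | sq i.+1 b c}.
  move=> ab; apply: cid.
  have [|c cE] := row_exact_mx (exA i).2 (X := D i.+1 *m b).
    by rewrite -mulmxA ab mulmxA DD mul0mx.
  by exists c.
pose f := fix f i : {a & {b | sq i a b}} :=
  match i with
  | 0%N => existT _ 1%:M (exist _ 1%:M sq0)
  | j.+1 => let c := next j _ _ (svalP (projT2 (f j))) in
            existT _ (sval (projT2 (f j))) (exist _ (sval c) (svalP c))
  end.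
exists (fun i => projT1 (f i)); split=> // i.
exact: (svalP (projT2 (f i))).
Qed.

Variable C : forall i, 'M[R]_(n i, q i).
Hypothesis C1 : C 1%N = 1%:M.
Hypothesis CA : forall i, C i.+1 *m A i = D i *m C i.

(* Boundaries of the mapping cone of C, acting on columns. *)
Definition cone_boundary s m (Y : 'M[R]_(q s.+2, m)) (Z : 'M[R]_(n s.+1, m)) :=
  exists (Y' : 'M[R]_(q s.+1, m)) (Z' : 'M[R]_(n s, m)),
    Y = A s.+1 *m Y' /\ Z = C s.+1 *m Y' - D s *m Z'.

Lemma cone_exact s m (Y : 'M[R]_(q s.+2, m)) (Z : 'M[R]_(n s.+1, m)) Y' :
  (s < k)%N -> Y = A s.+1 *m Y' -> C s.+2 *m Y = D s.+1 *m Z ->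
  cone_boundary Y Z.
Proof.
move=> lt_sk YE CY.
have [|Z' Z'E] := col_exact_mx (exD lt_sk) (Y := C s.+1 *m Y' - Z).
  by rewrite mulmxBr mulmxA -CA -mulmxA -YE CY subrr.
by exists Y', Z'; rewrite -Z'E opprB addrC subrK.
Qed.

(** Descent along the cone: if [(Y', Z')] bounds the product of [(Y, Z)] with V, its product with
    the next V is a cocycle, hence a boundary. Induction corrects [(Y', Z')] by multiples of V, and
    row exactness of V carries the correction back to [(Y, Z)]. *)
Lemma cone_boundary_lift (v : nat -> nat) (V : forall i, 'M[R]_(v i, v i.+1))
    s i (Y : 'M[R]_(q s.+2, v i.+1)) (Z : 'M[R]_(n s.+1, v i.+1)) :
  (s < k)%N ->
  (forall t, V t *m V t.+1 = 0) ->
  (forall t, (t <= s + i)%N -> forall f : 'rV[R]_(v t.+1), f *m V t.+1 = 0 ->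
     exists g, f = g *m V t) ->
  (forall t, (t < s)%N -> col_exact (A t.+2) (A t.+1)) ->
  cone_boundary (Y *m V i.+1) (Z *m V i.+1) ->
  exists g h, cone_boundary (Y - g *m V i) (Z - h *m V i).
Proof.
move=> + VV; elim: s i Y Z => [|s IHs] i Y Z lt_sk exV colA [Y' [Z' [YE ZE]]].
  have AA : A 1%N *m D 0%N = 0 by rewrite -A0; exact: (exA 0%N).1.
  (* At the bottom [C 1 = 1], so modulo boundaries only [Y - A 1 *m Z] matters, which lives in a
     free module. *)
  have [|g gE] := row_exact_mx (exV i (leq_addl _ _)) (X := Y - A 1%N *m Z).
    rewrite mulmxBl YE -mulmxA ZE C1 mul1mx mulmxBr.
    by rewrite [A 1%N *m (D 0%N *m Z')]mulmxA AA mul0mx subr0 subrr.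
  exists g, 0, Z, 0; rewrite -gE mul0mx mulmx0 C1 mul1mx !subr0.
  by rewrite opprB addrC subrK.
have [Y'' Y''E] : exists Y'', Y' *m V i.+2 = A s.+1 *m Y''.
  apply: (col_exact_mx (colA s (ltnSn s))).
  by rewrite mulmxA -YE -mulmxA VV mulmx0.
have [||||g [h [a [b [gE hE]]]]] := IHs i.+1 Y' Z'.
- exact: ltnW.
- by move=> t le_t; apply: exV; rewrite addSnnS.
- by move=> t lt_ts; apply: colA; apply: ltnW.
- apply: (cone_exact (ltnW lt_sk) Y''E); apply/eqP.
  rewrite -subr_eq0 !mulmxA -mulmxBl -ZE -mulmxA VV mulmx0.
  exact: eqxx.
have Y'E : Y' = A s.+1 *m a + g *m V i.+1 by rewrite -gE subrK.
have Z'E : Z' = C s.+1 *m a - D s *m b + h *m V i.+1 by rewrite -hE subrK.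
have [//|g' g'E] := row_exact_mx (exV i (leq_addl _ _)) (X := Y - A s.+2 *m g).
  rewrite mulmxBl YE Y'E mulmxDr mulmxA (exA s.+1).1 mul0mx add0r.
  by rewrite mulmxA subrr.
have [//|h' h'E] := row_exact_mx (exV i (leq_addl _ _))
    (X := Z - (C s.+2 *m g - D s.+1 *m h)).
  rewrite mulmxBl ZE Y'E Z'E mulmxBl.
  rewrite [C s.+2 *m (_ + _)]mulmxDr [D s.+1 *m (_ + _)]mulmxDr mulmxBr !mulmxA.
  by rewrite CA DD mul0mx subr0 [X in X - _ - _]addrC addrKA subrr.
exists g', h', g, h; rewrite -g'E -h'E.
by rewrite !opprB ![_ + (_ - _)]addrC !subrK.
Qed.

(* Hom(yR, I i) = 0 for the class y of a cocycle, with annihilator spanned by *)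
(* V. *)
Lemma cocycle_hom_eq0 i j (y : 'cV[R]_(q j.+2)) v (V : 'rV[R]_v)
    (x : 'rV[I i]_1) :
  (i <= j)%N -> (i < k)%N -> A j.+2 *m y = 0 ->
  (forall a y', y *m (a%:M : 'M_1) = A j.+1 *m y' -> exists z, a%:M = V *m z) ->
  vmul x V = 0 -> x = 0.
Proof.
move=> le_ij lt_ik Ay genV xV.
(* The map given by x on y and by 0 on the boundaries is well defined, and extends to some w on all
   columns. *)
have [||w] := injective_vmul (A := row_mx y (A j.+1)) (x := row_mx x 0).
- exact: cores_class.
- move=> t; rewrite -[t]vsubmxK mul_row_col vmul_row_col vmul0l addr0.
  rewrite [usubmx t]mx11_scalar => /eqP; rewrite addr_eq0 -mulmxN => /eqP.
  by move=> /genV[z ->]; rewrite -vmulA xV vmul0l.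
rewrite vmul_mul_row => /eq_row_mx[-> /esym wA].
(* Tor_(j+2) against [I i] vanishes since its flat dimension is at most i+1 <= j+1. *)
have [w' ->] := flat_dim_row_exact (t := j.+1) (Ifd lt_ik) le_ij exA wA.
by rewrite vmulA Ay vmul0r.
Qed.

Lemma Ext_zero_induction j : (j < k)%N ->
  (forall i, (i < j)%N -> col_exact (A i.+1) (A i)) ->
  col_exact (A j.+1) (A j).
Proof.
case: j => [|j] lt_jk colA; split; rewrite ?(exA _).1 // => y Ay.
  rewrite A0; apply: (exD lt_jk).2.
  by rewrite -[y]mul1mx -C1 mulmxA -CA -mulmxA Ay mulmx0.
have [z0 z0E] : exists z, C j.+2 *m y = D j.+1 *m z.
  by apply: (exD lt_jk).2; rewrite mulmxA -CA -mulmxA Ay mulmx0.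
(* J annihilates the class of y in Ext^(j+2), so this class spans a copy of R/J. *)
pose J : {pred R} := fun a =>
  `[< exists y', y *m (a%:M : 'M_1) = A j.+1 *m y' >].
have [||v [B BP]] := @noetherian_right_ideal R rnoe J.
- by apply/asboolP; exists 0; rewrite mulmx0 -scalemx1 scale0r mulmx0.
- move=> a b c /asboolP[y1 y1E] /asboolP[y2 y2E]; apply/asboolP.
  exists (y1 *m (c%:M : 'M_1) + y2); rewrite mulmxDr mulmxA -y1E -y2E.
  by rewrite -mulmxA -mulmxDr -scalar_mxM raddfD.
have [p' [V' [V'0 exV']]] := col_resolution rnoe B.
pose vd := scons 0%N (scons 1%N (scons v p')).
(* The empty matrix in front makes exactness at t = 0 say Hom(R/J, R) = 0, and makes the final
   correction [g *m V 0] zero. *)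
pose V i : 'M[R]_(vd i, vd i.+1) :=
  match i return 'M[R]_(vd i, vd i.+1) with 0%N => 0 | i'.+1 => V' i' end.
have VV i : V i *m V i.+1 = 0.
  by case: i => [|i]; [rewrite mul0mx | exact: (exV' i).1].
have exV t : (t <= j)%N -> forall f : 'rV[R]_(vd t.+1), f *m V t.+1 = 0 ->
    exists g, f = g *m V t.
  move=> le_tj; apply/(cosyzygy_lift0 I)/cosyzygy_lift_chain => //.
  move=> z zV; exists 0; rewrite -map_vmul vmul0l.
  have -> : map_mx (aug_d I t) (0 : 'rV[aug_obj I t]_(vd 1%N)) = 0.
    by apply/rowP=> i; rewrite !mxE linear0.
  apply: (@cocycle_hom_eq0 t j y _ B) => //.
  - exact: leq_ltn_trans le_tj (ltnW lt_jk).
  - by move=> a y' aE; apply/BP/asboolP; exists y'.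
  - by rewrite -V'0.
have [|||g [h [y' [z' [yE _]]]]] :=
    @cone_boundary_lift vd V j 0%N y z0 (ltnW lt_jk) VV.
- by move=> t; rewrite addn0; apply: exV.
- by move=> t lt_tj; apply: colA.
- have [Y' Y'E] : exists Y', y *m B = A j.+1 *m Y'.
    have colB l : exists y', y *m (B 0 l)%:M = A j.+1 *m y'.
      apply/asboolP/BP; exists (delta_mx l 0); rewrite -colE.
      by apply/matrixP=> i i'; rewrite !ord1 !mxE eqxx mulr1n.
    have [Y YE] := choice colB; exists (\matrix_(i, l) Y l i 0).
    apply/matrixP=> i l; have /matrixP/(_ i 0) := YE l.
    rewrite !mxE !big_ord1 !mxE eqxx mulr1n => ->.
    by apply: eq_bigr => i' _; rewrite mxE.
  apply: (cone_exact (ltnW lt_jk) (Y' := Y')); rewrite /V /= V'0 //.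
  by rewrite !mulmxA z0E.
by exists y'; rewrite -yE mulmx0 subr0.
Qed.

Lemma syzygy_col_exact j : (j < k)%N -> col_exact (A j.+1) (A j).
Proof.
elim/ltn_ind: j => j IHj lt_jk; apply: Ext_zero_induction => // i lt_ij.
by apply: IHj => //; apply: ltn_trans lt_jk.
Qed.

End SyzygyGrade.

(* A finite column resolution of B, listed from its far end; P keeps track of *)
(* the original matrix, whose dimensions are not definitionally those of D k. *)
Lemma reversed_col_resolution (R : pzRingType) (rnoe : right_noetherian R) k
    (P : forall b c, 'M[R]_(b, c) -> Prop) b c (B : 'M[R]_(b, c)) :
  P b c B ->
  exists n (D : forall i, 'M[R]_(n i.+1, n i)),
    [/\ forall i, D i.+1 *m D i = 0,
        forall i, (i < k)%N -> col_exact (D i.+1) (D i)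
      & P _ _ (D k)].
Proof.
move=> PB; elim: k => [|k [n [D [DD exD PD]]]].
  pose n := scons c (fun=> b).
  pose D i : 'M[R]_(n i.+1, n i) :=
    match i return 'M[R]_(n i.+1, n i) with 0%N => B | _.+1 => 0 end.
  by exists n, D; split=> // i; rewrite mul0mx.
have [d [C DC]] := col_syzygy rnoe (D 0).
pose n' := scons d n.
pose D' i : 'M[R]_(n' i.+1, n' i) :=
  match i return 'M[R]_(n' i.+1, n' i) with 0%N => C | j.+1 => D j end.
exists n', D'; split=> // -[|i] *; [exact: DC.1 | exact: DD | exact: DC |].
exact: exD.
Qed.

Lemma coker_reduced_grade (R : pzRingType) k (lnoe : left_noetherian R)
    (rnoe : right_noetherian R)
    (I : coresolution (@injective_module R^c) (R^c)^o) (n : nat -> nat)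
    (D : forall i, 'M[R]_(n i.+1, n i)) :
  (forall i, (i < k)%N -> flat_dim_right_le (I i) i.+1) ->
  (forall i, D i.+1 *m D i = 0) ->
  (forall i, (i < k)%N -> col_exact (D i.+1) (D i)) ->
  reduced_grade_ge k.+1 (coker (D 0)).
Proof.
move=> Ifd DD exD [//|j] lt_jk.
have [p [A [A0 exA]]] := row_resolution lnoe (D 0).
have [C [C1 CA]] := comparison_mx DD A0 exA.
have surj (m : coker (D 0)) : exists x, coker_pi (D 0) x = m.
  by exists (coker_repr m); apply: coker_reprK.
have ker x : coker_pi (D 0) x = 0 <-> exists w, x = w *m A 0.
  by rewrite A0; split=> [/coker_pi0/rowspanP|/rowspanP/coker_pi0].
apply/(Ext_zero_freeP surj ker exA).
exact: (syzygy_col_exact rnoe Ifd DD exD A0 exA C1 CA lt_jk).2.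
Qed.

(** * Bounding the injective dimension *)

Lemma torsionless_inj_dim (R : pzRingType) k (lnoe : left_noetherian R)
    (rnoe : right_noetherian R) :
  right_quasi_gorenstein k R ->
  (forall M : lmodType R,
     fin_gen M -> reduced_grade_ge k.+1 M -> torsionless M) ->
  inj_dim_le (R^c)^o k.
Proof.
move=> [I [[ess0 ess] Ifd]] tless; exists I.
(* If the differential leaving I_k is zero, its image is zero yet essential in the next term, so
   that term vanishes, and so do all later ones. *)
suff surj : forall x : aug_obj I k.+1, aug_d I k.+1 x = 0.
  have zero i (x : I i) : (forall y, cores_d I i y = 0) -> cores_d I i x = 0.
    by move=> ->.
  have essE i : (forall y : I i, cores_d I i y = 0) -> forall x : I i.+1, x = 0.
    move=> di0 x; apply/eqP/negPn/negP => xN0.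
    have [||y _] := ess i predT; [by split | by exists x |].
    by rewrite di0 eqxx.
  have : forall i (x : I (k + i)%N), cores_d I (k + i) x = 0.
    elim=> [|i IHi]; first by rewrite addn0; exact: surj.
    rewrite addnS => x; rewrite (essE _ IHi x) linear0 //.
  move=> d0 [//|i]; rewrite ltnS => /subnKC <- x; exact: essE.
move=> x.
pose J : {pred R} := fun a => `[< aug_d I k.+1 ((a : R^c) *: x) = 0 >].
have [||m [B BP]] := @noetherian_right_ideal R rnoe J.
- by apply/asboolP; rewrite (@scale0r R^c) linear0.
- move=> a b c /asboolP aJ /asboolP bJ; apply/asboolP.
  rewrite -[X in X *: x]/((c : R^c) * (a : R^c) + b) scalerDl -scalerA.
  by rewrite linearP aJ bJ scaler0 addr0.
(* For the generators B of J this holds with [x' = x]: modulo the image of [d k], x defines a map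
   from J into the k-th cosyzygy, and extending that map to R gives [d x = 0]. *)
pose lifts b c (A : 'M[R]_(b, c)) := exists x' : 'rV[aug_obj I k.+1]_b,
  map_mx (aug_d I k.+1) (vmul x' A) = 0 /\
  forall v : 'rV[aug_obj I k]_b, vmul (x' - map_mx (aug_d I k) v) A = 0 ->
    aug_d I k.+1 x = 0.
have [|n [D [DD exD [x' [x'D x'P]]]]] :=
    @reversed_col_resolution R rnoe k lifts _ _ B.
  exists (const_mx x); split=> [|v].
    apply/rowP=> l; rewrite !mxE big_ord1 mxE.
    have /asboolP -> // : B 0 l \in J.
    apply/BP; exists (delta_mx l 0); rewrite -colE.
    by apply/matrixP=> i i'; rewrite !ord1 !mxE eqxx mulr1n.
  set y := _ - _ => yB.
  have yE : y 0 0 = x - aug_d I k (v 0 0) by rewrite !mxE.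
  pose T : {pred aug_obj I k.+1} := fun z =>
    `[< exists a : R^c, z = a *: y 0 0 >].
  have Tc : GRing.submod_closed T.
    split=> [|c _ _ /asboolP[a ->] /asboolP[b ->]]; apply/asboolP.
      by exists 0; rewrite scale0r.
    by exists (c * a + b); rewrite scalerDl scalerA.
  suff : y 0 0 = 0.
    by rewrite yE => /eqP; rewrite subr_eq0 => /eqP ->; rewrite aug_dd.
  (* Otherwise yR meets the image of [d k] in some nonzero y a; then a lies in J, and y kills J
     because it kills B. *)
  apply/eqP/negPn/negP => yN0.
  have essk : essential_image (aug_d I k) by case: (k).
  have [|u /asboolP[a uE]] := essk T Tc.
    by exists (y 0 0) => //; apply/asboolP; exists 1; rewrite scale1r.
  have /BP[z aE] : (a : R) \in J.
    apply/asboolP; rewrite -[x](subrK (aug_d I k (v 0 0))) -yE scalerDr -uE.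
    by rewrite -linearZ -linearD aug_dd.
  have : vmul y (a%:M : 'M[R]_1) = 0 by rewrite aE -vmulA yB vmul0l.
  by move/rowP/(_ 0); rewrite !mxE big_ord1 mxE eqxx uE => ->; rewrite eqxx.
have tM : torsionless (coker (D 0)).
  apply: tless; last exact: coker_reduced_grade Ifd DD exD.
  exists (n 0%N), (fun i => coker_pi (D 0) (delta_mx 0 i)) => m0.
  exists (fun i => coker_repr m0 0 i); rewrite -{1}(coker_reprK m0).
  exact: (row_linE (coker_pi (D 0))).
have [d [C DC]] := col_syzygy rnoe (D 0).
have lift0 : cosyzygy_lift I 0 (D 0) C.
  apply/cosyzygy_lift0 => f fC.
  move: tM => /(@torsionlessP _ _ _ _ (D 0) (coker_pi (D 0) : {linear _ -> _})).
  apply.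
  - by move=> m0; exists (coker_repr m0); apply: coker_reprK.
  - by move=> z; split=> [/coker_pi0/rowspanP|/rowspanP/coker_pi0].
  by move=> z /DC.2[w ->]; rewrite mulmxA fC mul0mx.
(* Torsionlessness is level 0 at [D 0]; k shifts up reach level k at [D k], that is, Ext^(k+1)(R/J,
   R) = 0. *)
have {lift0 DC} [e [E [DE liftk]]] :
    exists e (E : 'M[R]_(n k, e)), D k *m E = 0 /\ cosyzygy_lift I k (D k) E.
  elim: (k) exD => [|k' IHk] exD; first by exists d, C; case: DC.
  have [|e [E [DE liftk]]] := IHk; first by move=> i /leqW; apply: exD.
  exists (n k'), (D k'); split; first exact: DD.
  exact: cosyzygy_lift_up (exD _ (ltnSn k')) DE liftk.
have [u uE] := aug_exact_mx x'D.
have [|v vE] := liftk u; first by rewrite -uE vmulA DE vmul0r.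
by apply: (x'P v); rewrite vmulBl uE vE subrr.
Qed.

Theorem theorem2p3 (R : pzRingType) (k : nat) (k_gt0 : (0 < k)%N)
    (lnoeth : left_noetherian R) (rnoeth : right_noetherian R)
    (gor : right_quasi_gorenstein k R) :
  (inj_dim_le (R^c)^o k <->
     (forall M : lmodType R,
        fin_gen M -> reduced_grade_ge k.+1 M -> reflexive_module M)) /\
  ((forall M : lmodType R,
        fin_gen M -> reduced_grade_ge k.+1 M -> reflexive_module M) <->
     (forall M : lmodType R,
        fin_gen M -> reduced_grade_ge k.+1 M -> torsionless M)).
Proof.
have reflexive_torsionless (M : lmodType R) :
    reflexive_module M -> torsionless M.
  exact: bij_inj.
have ref1 : inj_dim_le (R^c)^o k -> forall M : lmodType R,
    fin_gen M -> reduced_grade_ge k.+1 M -> reflexive_module M.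
  by move=> idR M; apply: inj_dim_reflexive.
have id3 := torsionless_inj_dim lnoeth rnoeth gor.
split; split=> //.
- by move=> refM; apply: id3 => M fgM gM; apply/reflexive_torsionless/refM.
- by move=> refM M fgM gM; apply/reflexive_torsionless/refM.
by move=> /id3.
Qed.
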